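(* Let $l_4$ denote an open polygonal curve with 4 edges in 3-space. The double alternating self-linking integral of $l_4$ is given by the (signed) geometric probability that $l_4$ gives the knotoid $k2.1$ in a projection direction, namely $$SLL(l_4)=\frac12\,P\bigl((l_4)_{\vec\xi}=k2.1\bigr).$$
   Context: For $\vec\xi\in S^2$, $(l_4)_{\vec\xi}$ is the projection of $l_4$ to the plane with normal vector $\vec\xi$, viewed as a knotoid diagram (a generic immersed oriented arc with over/under information at its double points, considered up to Reidemeister moves performed away from the endpoints). $P((l_4)_{\vec\xi}=k2.1)$ is the geometric probability, i.e. $\frac{1}{4\pi}$ times the area of the set of $\vec\xi\in S^2$ for which $(l_4)_{\vec\xi}$ is a diagram of $k2.1$. Here $k2.1$ is the simplest non-trivial knotoid in the knotoid tables (taken up to mirror image and reversal): the knotoid with a two-crossing diagram in which, traversing from start to end, one meets crossing 1, crossing 2, crossing 1, crossing 2, with one of the two crossings passed first over then under and the other first under then over; its two crossings have equal sign. With $\gamma:[0,1]\to\mathbb{R}^3$ a parametrization of a curve $l$, the double alternating self-linking integral is $$SLL(l)=\frac{1}{8\pi}\int_{\vec\xi\in S^2}\ \sum_{(j_1,j_2,j_3,j_4)\in I_{\vec\xi}^*}\epsilon(j_1,j_3)\,\epsilon(j_2,j_4)\,dA,$$ where $\epsilon(s,t)=\pm1$ is the sign of the crossing between the projections of $\gamma(s)$ and $\gamma(t)$, and $I_{\vec\xi}^*$ is the set of 4-tuples $j_1>j_2>j_3>j_4$ such that $j_1,j_3$ are the two passages through one crossing of the projection of $l$ to the plane with normal vector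 $\vec\xi$, $j_2,j_4$ are the two passages through another crossing, and $j_1$ belongs to the over-arc of its crossing while $j_2$ belongs to the under-arc of its crossing, or vice versa. Integrals over $S^2$ omit the measure-zero set of non-generic projection directions. *)

(* Defs.v *)
From Stdlib Require Import Relation_Operators.
From mathcomp Require Import all_boot all_order all_algebra.
From mathcomp Require Import all_classical all_reals all_analysis.

Set Implicit Arguments.
Unset Strict Implicit.
Unset Printing Implicit Defensive.

Import Order.TTheory GRing.Theory Num.Theory.
Import numFieldNormedType.Exports.

(* A diagram of an oriented arc on the sphere, up to isotopy of the sphere, is
   recorded by its signed Gauss code: the sequence of passages through the
   crossings met from the start to the end of the arc.  A passage is a triple
   (label of the crossing, is it the over-passage?, is the crossing
   positive?). *)
Definition passage : Type := (nat * bool * bool)%type.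
Definition gauss_code : Type := seq passage.

Definition label (x : passage) : nat := x.1.1.
Definition is_over (x : passage) : bool := x.1.2.
Definition is_pos (x : passage) : bool := x.2.

Definition opposite (x : passage) : passage := (label x, ~~ is_over x, is_pos x).
Definition relabel (f : nat -> nat) (w : gauss_code) : gauss_code :=
  [seq (f (label x), is_over x, is_pos x) | x <- w].

Definition gauss_word (w : gauss_code) : bool :=
  all (fun x => perm_eq [seq y <- w | label y == label x] [:: x; opposite x]) w.

(* Rotation system of a Gauss code.  The passages are numbered 0, ..., n - 1
   and edge i of the arc, for 0 <= i <= n, runs from passage i - 1 to passage i,
   edges 0 and n being incident to the endpoints.  A dart (i, b) is edge i
   traversed along the arc if b = true, and against it if b = false. *)
Definition dart : Type := (nat * bool)%type.
Definition darts (w : gauss_code) : seq dart :=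
  [seq (i, b) | i <- iota 0 (size w).+1, b <- [:: true; false]].

Definition partner (w : gauss_code) (k : nat) : nat :=
  let ls := map label w in
  let l := nth 0 ls k in
  let i := index l ls in
  if i == k then i.+1 + index l (drop i.+1 ls) else i.

(* The dart following d on the boundary of the face on the left of d: turn left
   at a crossing, and turn back at an endpoint.  At passage k the other strand
   goes from right to left exactly when passage k is the over-passage of a
   positive crossing or the under-passage of a negative one. *)
Definition face_next (w : gauss_code) (d : dart) : dart :=
  let turn k fwd :=
    let x := nth (0, false, false) w k in
    let right_to_left := is_over x == is_pos x in
    if right_to_left == fwd then ((partner w k).+1, true)
    else (partner w k, false) in
  match d with
  | (i, true) => if i == size w then (i, false) else turn i true
  | (0, false) => (0, true)
  | (i.+1, false) => turn i false
  end.

(* The number of orbits of face_next; each orbit is counted at its earliest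
   dart. *)
Definition nb_faces (w : gauss_code) : nat :=
  count (fun d => all (fun e => index d (darts w) <= index e (darts w))
                      (traject (face_next w) d (size (darts w))))
        (darts w).

(* Euler characteristic 2: with 2c passages the underlying connected graph has
   c crossings, 2 endpoints and 2c + 1 edges, hence c + 1 faces. *)
Definition spherical (w : gauss_code) : bool :=
  (nb_faces w).*2 == (size w).+2.

Definition knotoid_diagram : Type :=
  {w : gauss_code | gauss_word w && spherical w}.

(* In R3 the strands t, m, b are the top, middle and bottom ones, with
   crossings p (t over m), q (t over b) and r (m over b).  For three oriented
   lines in the plane whose crossings p, q, r have signs e1, e2, e3, the order
   of the two crossings along each line is the one given by triangle, or its
   reverse on all three lines. *)
Definition orient (b : bool) (s : gauss_code) : gauss_code :=
  if b then s else rev s.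
Definition triangle (p q r : nat) (e1 e2 e3 : bool) : seq gauss_code :=
  [:: orient (e1 (+) e2 (+) e3) [:: (p, true, e1); (q, true, e2)];
      orient e1 [:: (p, false, e1); (r, true, e3)];
      orient e2 [:: (q, false, e2); (r, false, e3)]].

(* Moves away from the endpoints: no passage is ever added or removed without
   its partner.  Only moves between knotoid diagrams are used below, so the
   labels created by R1 and R2 are fresh, and R2 is performed between two edges
   of a common face. *)
Inductive reidemeister : gauss_code -> gauss_code -> Prop :=
| R0 (f : nat -> nat) (w : gauss_code) of injective f :
    reidemeister w (relabel f w)
| R1 (x y : gauss_code) (a : nat) (o e : bool) :
    reidemeister (x ++ y) (x ++ [:: (a, o, e); (a, ~~ o, e)] ++ y)
| R2 (x y z : gauss_code) (a b : nat) (o e parallel : bool) :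
    let s := [:: (a, o, e); (b, o, ~~ e)] in
    reidemeister (x ++ y ++ z)
                 (x ++ s ++ y ++ orient parallel (map opposite s) ++ z)
| R3 (x y z u s1 s2 s3 : gauss_code) (p q r : nat) (e1 e2 e3 : bool)
    of perm_eq [:: s1; s2; s3] (triangle p q r e1 e2 e3) :
    reidemeister (x ++ s1 ++ y ++ s2 ++ z ++ s3 ++ u)
                 (x ++ rev s1 ++ y ++ rev s2 ++ z ++ rev s3 ++ u).

Definition knotoid_equiv : knotoid_diagram -> knotoid_diagram -> Prop :=
  clos_refl_sym_trans knotoid_diagram
    (fun D D' => reidemeister (sval D) (sval D')).

(* The choices of o and e account for mirror images and reversal. *)
Definition k2_1_standard (D : knotoid_diagram) : Prop :=
  exists (a b : nat) (o e : bool), a != b /\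
    sval D = [:: (a, o, e); (b, ~~ o, e); (a, ~~ o, e); (b, o, e)].

Definition is_k2_1 (D : knotoid_diagram) : Prop :=
  exists2 D0, k2_1_standard D0 & knotoid_equiv D D0.

Local Open Scope classical_set_scope.
Local Open Scope ring_scope.

Definition dot (R : realType) (u v : 'rV[R]_3) : R :=
  \sum_(i < 3) u 0 i * v 0 i.

Definition det3 (R : realType) (u v w : 'rV[R]_3) : R :=
  \det (\matrix_(i < 3) [:: u; v; w]`_i).

(* A curve is given by a parametrization, of which only the restriction to
   [0, 1] matters; directions xi are unit vectors. *)
Definition proj (R : realType) (xi x : 'rV[R]_3) : 'rV[R]_3 :=
  x - dot x xi *: xi.

Definition double_point (R : realType) (g : R -> 'rV[R]_3) (xi : 'rV[R]_3)
    (s t : R) : Prop :=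
  [/\ 0 <= s <= 1, 0 <= t <= 1, s != t & proj xi (g s) = proj xi (g t)].

Definition over (R : realType) (g : R -> 'rV[R]_3) (xi : 'rV[R]_3)
    (s t : R) : bool :=
  dot (g t) xi < dot (g s) xi.

(* Finitely many multiple points, all of them transverse double points with
   distinct heights, away from the endpoints and from the corners of the curve.
   Finiteness also makes the projection locally injective. *)
Definition generic (R : realType) (g : R -> 'rV[R]_3) (xi : 'rV[R]_3) : Prop :=
  [/\ finite_set [set st : R * R | double_point g xi st.1 st.2],
      (forall s t u, double_point g xi s t -> double_point g xi s u -> t = u) &
      (forall s t, double_point g xi s t ->
        [/\ 0 < s < 1, derivable g s 1, dot (g s) xi != dot (g t) xi &
            det3 (derive1 g s) (derive1 g t) xi != 0])].

(* A crossing is positive when the under-strand crosses the over-strand from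
   right to left, as seen from the side of xi. *)
Definition crossing_sign (R : realType) (g : R -> 'rV[R]_3) (xi : 'rV[R]_3)
    (s t : R) : R :=
  Num.sg (if over g xi s t then det3 (derive1 g s) (derive1 g t) xi
          else det3 (derive1 g t) (derive1 g s) xi).

Definition is_gauss_code (R : realType) (g : R -> 'rV[R]_3) (xi : 'rV[R]_3)
    (w : gauss_code) : Prop :=
  exists ts : seq R,
    [/\ sorted <%R ts,
        (forall t, (t \in ts) <-> exists s, double_point g xi t s),
        size w = size ts &
        forall i j, (i < size ts)%N -> (j < size ts)%N -> i != j ->
          let x := nth (0%N, false, false) w in
          let t := nth 0 ts in
          (label (x i) = label (x j) <-> double_point g xi (t i) (t j)) /\
          (double_point g xi (t i) (t j) ->
             is_over (x i) = over g xi (t i) (t j) /\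
             is_pos (x i) = (0 < crossing_sign g xi (t i) (t j)))].

Definition projects_to_k2_1 (R : realType) (g : R -> 'rV[R]_3)
    (xi : 'rV[R]_3) : Prop :=
  exists2 D : knotoid_diagram, is_gauss_code g xi (sval D) & is_k2_1 D.

(* Spherical coordinates, u = (longitude, colatitude), with
   dA = sin(colatitude) d(longitude) d(colatitude). *)
Definition sphere_point (R : realType) (u : R * R) : 'rV[R]_3 :=
  \row_(i < 3) [:: sin u.2 * cos u.1; sin u.2 * sin u.1; cos u.2]`_i.

Definition sphere_integral (R : realType) (f : 'rV[R]_3 -> R) : \bar R :=
  (\int[(@lebesgue_measure R \x @lebesgue_measure R)%E]_(u in
      `[0%R, (pi *+ 2)%R] `*` `[0%R, pi])
      (f (sphere_point u) * sin u.2)%:E)%E.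

Definition sphere_area (R : realType) (A : set 'rV[R]_3) : \bar R :=
  sphere_integral \1_A.

Definition geometric_probability (R : realType) (A : set 'rV[R]_3) : \bar R :=
  (((4 * pi)^-1)%:E * sphere_area A)%E.

(* I^*_xi *)
Definition alternating_pairs (R : realType) (g : R -> 'rV[R]_3)
    (xi : 'rV[R]_3) : set (R * R * R * R) :=
  [set j | let: (j1, j2, j3, j4) := j in
    [/\ [/\ j2 < j1, j3 < j2 & j4 < j3],
        double_point g xi j1 j3, double_point g xi j2 j4 &
        (over g xi j1 j3 /\ over g xi j4 j2) \/
        (over g xi j3 j1 /\ over g xi j2 j4)]].

Definition alternating_sum (R : realType) (g : R -> 'rV[R]_3)
    (xi : 'rV[R]_3) : R :=
  \sum_(j \in alternating_pairs g xi)
    let: (j1, j2, j3, j4) := j in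
    crossing_sign g xi j1 j3 * crossing_sign g xi j2 j4.

Definition SLL (R : realType) (g : R -> 'rV[R]_3) : \bar R :=
  (((8 * pi)^-1)%:E *
   sphere_integral (fun xi =>
     if `[< generic g xi >] then alternating_sum g xi else 0%R))%E.

(* The polygonal curve with vertices p 0, ..., p n: on [i/n, (i+1)/n] it runs
   along the edge from p i to p (i + 1) at constant speed. *)
Definition polygonal_curve (R : realType) (n : nat) (p : 'I_n.+1 -> 'rV[R]_3)
    (t : R) : 'rV[R]_3 :=
  p ord0 + \sum_(i < n) Num.min 1 (Num.max 0 (n%:R * t - i%:R)) *:
                        (p (lift ord0 i) - p (widen_ord (leqnSn n) i)).

(* Main.v *)
Require Import Defs.
From mathcomp Require Import all_boot all_order all_algebra.
From mathcomp Require Import zify ring lra.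
From mathcomp Require Import finmap all_classical all_reals all_analysis.
(* [over] is also a constant of ssreflect. *)
Import Defs.

(* Both sides are integrals over the sphere, and the integrands agree at every
   generic direction.  The signed count of interlaced alternating pairs of
   crossings is the sum of the two Gauss diagram formulas of order 2 for long
   virtual knots, so it is invariant under the Reidemeister moves; it is 1 on
   k2.1, hence a projection to k2.1 has count 1.  For the converse, only the
   pairs of edges (0, 2), (0, 3) and (1, 3) can cross.  Edges 2 and 3 cross
   edge 0 in opposite directions, and so do edges 0 and 1 with respect to edge
   3, so with at most two crossings the count is 0 unless the diagram is the
   standard one of k2.1.  If there are crossings a of (0, 2) and c of (1, 3),
   there is a crossing b of (0, 3), the Gauss word is abcabc, and b cannot be
   the only crossing with a different over/under type, since its height
   difference is a positive combination of those of a and c; the contributions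
   then cancel. *)

Set Implicit Arguments.
Unset Strict Implicit.
Unset Printing Implicit Defensive.

Import Order.TTheory GRing.Theory Num.Theory.
Import numFieldNormedType.Exports.
Local Open Scope classical_set_scope.
Local Open Scope ring_scope.

(** * Invariance of the alternating number *)

Definition sgn (x : passage) : int := if is_pos x then 1 else -1.

(** The sequences kept are over-under-under-over and its opposite. The pair [(a, b)] is ordered by
    first passage, so an interlaced pair of crossings is counted once in the double sum of
    [alt_number]. *)
Definition alt_pattern (a b : nat) (v : gauss_code) : int :=
  if v is [:: x1; x2; x3; x4] then
    if [&& a != b, label x1 == a, label x2 == b, label x3 == a, label x4 == b,
        is_over x1 != is_over x2, is_over x1 != is_over x3
        & is_over x2 != is_over x4] then sgn x1 * sgn x2 else 0
  else 0.

Definition sub_code (a b : nat) (w : gauss_code) : gauss_code :=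
  [seq y <- w | (label y == a) || (label y == b)].

Definition alt_pair (w : gauss_code) (a b : nat) : int :=
  alt_pattern a b (sub_code a b w).

Definition alt_number (w : gauss_code) : int :=
  \sum_(a <- undup (map label w)) \sum_(b <- undup (map label w)) alt_pair w a b.

Lemma labelE (a : nat) (o e : bool) : label (a, o, e) = a.
Proof. by []. Qed.

Lemma is_overE (a : nat) (o e : bool) : is_over (a, o, e) = o.
Proof. by []. Qed.

Lemma is_posE (a : nat) (o e : bool) : is_pos (a, o, e) = e.
Proof. by []. Qed.

Lemma alt_pattern_neq0 a b v : alt_pattern a b v != 0 ->
  exists x1 x2 x3 x4, [/\ v = [:: x1; x2; x3; x4], a != b,
    [/\ label x1 = a, label x2 = b, label x3 = a & label x4 = b],
    [/\ is_over x1 != is_over x2, is_over x1 != is_over x3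
      & is_over x2 != is_over x4] & alt_pattern a b v = sgn x1 * sgn x2].
Proof.
case: v => [|x1 [|x2 [|x3 [|x4 [|x5 v]]]]]; rewrite /= ?eqxx //.
case: ifP; rewrite ?eqxx // =>
  /and5P[ab /eqP l1 /eqP l2 /eqP l3 /and4P[/eqP l4 o1 o2 o3]] _.
by exists x1, x2, x3, x4; split.
Qed.

Lemma alt_pairxx w a : alt_pair w a a = 0.
Proof.
apply/eqP/contraT => /alt_pattern_neq0[x1 [x2 [x3 [x4 []]]]].
by rewrite eqxx.
Qed.

Lemma alt_pair_notin w a b :
  (a \notin map label w) || (b \notin map label w) -> alt_pair w a b = 0.
Proof.
move=> ab; apply/eqP/contraT => /alt_pattern_neq0.
move=> [x1 [x2 [x3 [x4 [e _ [l1 l2 _ _] _ _]]]]].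
have sub x : x \in sub_code a b w -> label x \in map label w.
  by rewrite mem_filter => /andP[_ xw]; apply: map_f.
by move: ab; rewrite -l1 -l2 !sub // e !inE eqxx ?orbT.
Qed.

Lemma sum_uniq_support (V : zmodType) (I : eqType) (s t : seq I) (F : I -> V) :
  uniq s -> uniq t -> {subset t <= s} -> (forall i, i \notin t -> F i = 0) ->
  \sum_(i <- s) F i = \sum_(i <- t) F i.
Proof.
move=> us ut ts F0.
rewrite (bigID (mem t)) /= [X in _ + X]big1 ?addr0; last by move=> i /F0.
rewrite -big_filter; apply: perm_big; apply: uniq_perm => //.
  exact: filter_uniq.
by move=> i; rewrite mem_filter /=; case: (boolP (i \in t)) => //= /ts.
Qed.

(** Labels absent from [w] contribute nothing. The freedom in [L] lets the codes before and after a
    move be summed over a common list of labels. *)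
Lemma alt_numberE w L : uniq L -> {subset map label w <= L} ->
  alt_number w = \sum_(a <- L) \sum_(b <- L) alt_pair w a b.
Proof.
move=> uL sL.
have uw := undup_uniq (map label w).
have sw : {subset undup (map label w) <= L} by move=> x; rewrite mem_undup => /sL.
rewrite (sum_uniq_support uL uw sw) => [|a aw].
  apply: eq_bigr => a _; rewrite (sum_uniq_support uL uw sw) // => b bw.
  by rewrite mem_undup in bw; rewrite alt_pair_notin ?bw ?orbT.
by rewrite mem_undup in aw; rewrite big1 // => b _; rewrite alt_pair_notin ?aw.
Qed.

(** [alt_pattern] only tests labels for equality. Injectivity is asked on the labels of [w] alone
    because some renamings below are injective only there. *)
Lemma alt_number_relabel f w : {in map label w &, injective f} ->
  alt_number (relabel f w) = alt_number w.
Proof.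
move=> fI.
have mf : map label (relabel f w) = map f (map label w) by rewrite -!map_comp.
set L := undup (map label w).
have fIL : {in L &, injective f} by move=> a b; rewrite !mem_undup; apply: fI.
rewrite (@alt_numberE _ (map f L)); first last.
- by rewrite mf => _ /mapP[x xw ->]; rewrite map_f // mem_undup.
- by rewrite map_inj_in_uniq // undup_uniq.
rewrite big_map /alt_number -/L; apply: eq_big_seq => a aL.
rewrite big_map; apply: eq_big_seq => b bL; rewrite /alt_pair.
have -> : sub_code (f a) (f b) (relabel f w) = relabel f (sub_code a b w).
  rewrite /sub_code /relabel filter_map; congr map; apply: eq_in_filter => x xw.
  have xL : label x \in L by rewrite mem_undup map_f.
  by rewrite /preim /= /label /= !(inj_in_eq fIL).
have : {subset map label (sub_code a b w) <= L}.
  move=> _ /mapP[x + ->]; rewrite mem_filter => /andP[_ xw].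
  by rewrite mem_undup map_f.
case: (sub_code a b w) => [|x1 [|x2 [|x3 [|x4 [|x5 v]]]]] //= sL.
by rewrite /label /= !(inj_in_eq fIL) // sL // !inE eqxx ?orbT.
Qed.

(** * Labels in Gauss words and the first Reidemeister move *)

Lemma gauss_count w a : gauss_word w -> (count_mem a (map label w) <= 2)%N.
Proof.
move=> gw; have [|/count_memPn->//] := boolP (a \in map label w).
case/mapP => x xw ->; move/allP/(_ _ xw)/perm_size: gw.
by rewrite size_filter count_map /= => ->.
Qed.

(** A label occurs at most twice in a Gauss word, so two occurrences in [s] leave none for [v]. This
    recovers the freshness of the labels created by a move. *)
Lemma gauss_fresh w s v a : gauss_word w -> perm_eq w (s ++ v) ->
  (1 < count_mem a (map label s))%N -> a \notin map label v.
Proof.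
move=> gw /(perm_map label)/permP/(_ (pred1 a)) e s2; have := gauss_count a gw.
rewrite e map_cat count_cat => le2; apply/count_memPn/eqP.
by rewrite -leqn0 -(leq_add2l 2) addn0 (leq_trans _ le2) ?leq_add2r.
Qed.

Lemma sub_code_nil a b x : a \notin map label x -> b \notin map label x ->
  sub_code a b x = [::].
Proof.
move=> ax bx; apply/eqP; rewrite -size_eq0 size_filter -leqn0 leqNgt -has_count.
apply/hasPn => y yx; apply/norP.
by split; [apply: contraNneq ax|apply: contraNneq bx] => <-; apply: map_f.
Qed.

Lemma sub_code_cat a b x y : sub_code a b (x ++ y) = sub_code a b x ++ sub_code a b y.
Proof. exact: filter_cat. Qed.

Lemma sub_codeC a b x : sub_code a b x = sub_code b a x.
Proof. by apply: eq_filter => y; rewrite orbC. Qed.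

(** In the pattern [abab] consecutive labels differ, so a kink cannot belong to a counted pair. *)
Lemma alt_pattern_adjacent a b x y u v : label u = label v ->
  alt_pattern a b (x ++ [:: u; v] ++ y) = 0.
Proof.
move=> uv; apply/eqP/contraT => /alt_pattern_neq0.
move=> [x1 [x2 [x3 [x4 [e ab [l1 l2 l3 l4] _ _]]]]].
have ne : [&& label x1 != label x2, label x2 != label x3 & label x3 != label x4].
  by rewrite l1 l2 l3 l4 ab eq_sym ab.
have := congr1 size e; rewrite !size_cat /= => sx.
case: x e sx => [|? [|? [|? x]]] /= e sx; try lia; case: e => *; subst;
  by move: ne; rewrite uv !eqxx ?andbF.
Qed.

Lemma alt_number_r1 (x y : gauss_code) (a : nat) (o e : bool) :
  gauss_word (x ++ [:: (a, o, e); (a, ~~ o, e)] ++ y) ->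
  alt_number (x ++ [:: (a, o, e); (a, ~~ o, e)] ++ y) = alt_number (x ++ y).
Proof.
move=> gw.
have axy : a \notin map label (x ++ y).
  apply: (gauss_fresh (s := [:: (a, o, e); (a, ~~ o, e)]) gw); last by rewrite /= eqxx.
  by apply/permP => P; rewrite !count_cat addnCA.
rewrite [RHS](@alt_numberE _
  (undup (map label (x ++ [:: (a, o, e); (a, ~~ o, e)] ++ y)))) ?undup_uniq //;
  last first.
  by move=> i; rewrite mem_undup !map_cat !mem_cat => /orP[]->; rewrite ?orbT.
apply: eq_bigr => c _; apply: eq_bigr => d _; rewrite /alt_pair.
rewrite sub_code_cat (sub_code_cat c d [:: _; _]) [sub_code c d [:: _ ; _]]/sub_code.
(* A pair involving the kink contributes zero on both sides: by adjacency before the removal, by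
   absence of [a] after it. Other pairs do not see the kink. *)
rewrite /= !labelE; have [cd|_] := boolP ((a == c) || _); last by rewrite -sub_code_cat.
rewrite alt_pattern_adjacent //.
apply/esym; have := @alt_pair_notin (x ++ y) c d; rewrite /alt_pair sub_code_cat => -> //.
by case/orP: cd => /eqP <-; rewrite axy ?orbT.
Qed.

(** * Second Reidemeister move *)

Definition swap_label (a b : nat) (y : passage) : passage :=
  if label y == a then (b, is_over y, ~~ is_pos y) else y.

(** [swap_label] trades a passage of one bigon crossing for the matching passage of the other: the
    level is kept and the sign reversed. Exactly one factor of the product of signs changes. *)
Lemma alt_pattern_swap a b d v : a != d -> b != d ->
  {subset map label v <= [:: a; d]} ->
  alt_pattern b d (map (swap_label a b) v) = - alt_pattern a d v /\
  alt_pattern d b (map (swap_label a b) v) = - alt_pattern d a v.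
Proof.
move=> ad bd; case: v => [|x1 [|x2 [|x3 [|x4 [|x5 v]]]]] //= sv; rewrite ?oppr0 //.
have P y : label y \in [:: a; d] ->
  [/\ (label (swap_label a b y) == b) = (label y == a),
      (label (swap_label a b y) == d) = (label y == d),
      is_over (swap_label a b y) = is_over y &
      sgn (swap_label a b y) = if label y == a then - sgn y else sgn y].
  rewrite !inE /swap_label => /orP[]/eqP e; rewrite e.
    rewrite eqxx labelE /sgn /is_pos /is_over /= eqxx (negbTE ad) (negbTE bd).
    by split => //; case: y.2.
  by rewrite [d == a]eq_sym (negbTE ad) e [d == b]eq_sym (negbTE bd) eqxx.
have [] := P x1; first by apply: sv; rewrite !inE eqxx.
move=> -> -> -> ->.
have [] := P x2; first by apply: sv; rewrite !inE eqxx ?orbT.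
move=> -> -> -> ->.
have [] := P x3; first by apply: sv; rewrite !inE eqxx ?orbT.
move=> -> -> -> _.
have [] := P x4; first by apply: sv; rewrite !inE eqxx ?orbT.
move=> -> -> -> _.
rewrite [d == a]eq_sym [d == b]eq_sym ad bd /=.
split; case: ifP; rewrite ?oppr0 // => /and5P[/eqP -> /eqP -> _ _ _].
  by rewrite eqxx [d == a]eq_sym (negbTE ad) mulNr.
by rewrite eqxx [d == a]eq_sym (negbTE ad) mulrN.
Qed.

Lemma sub_code_swap a b d x : a \notin map label x -> b \notin map label x ->
  sub_code b d x = map (swap_label a b) (sub_code a d x).
Proof.
elim: x => //= y x IH; rewrite !inE !negb_or => /andP[ay ax] /andP[yb bx].
rewrite [label y == a]eq_sym [label y == b]eq_sym (negbTE ay) (negbTE yb) /=.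
by case: eqP => _; rewrite /= [RHS]/= -IH // /swap_label eq_sym (negbTE ay).
Qed.

Lemma alt_number_r2 (x y z : gauss_code) (a b : nat) (o e parallel : bool) :
  let s := [:: (a, o, e); (b, o, ~~ e)] in
  let w := x ++ s ++ y ++ orient parallel (map opposite s) ++ z in
  gauss_word w -> alt_number w = alt_number (x ++ y ++ z).
Proof.
move=> s w gw.
pose s' := orient parallel (map opposite s).
have ms' : map label s' =i [:: a; b].
  by rewrite /s'; case: (parallel) => i; rewrite // !inE orbC.
(* If [a = b], this label would occur twice in [s] and again in [s']. *)
have ab : a != b.
  apply/eqP => ab; have : a \notin map label (x ++ y ++ s' ++ z).
    apply: (gauss_fresh (s := s) gw); last by rewrite /= -ab eqxx.
    by rewrite perm_catCA.
  by rewrite !map_cat !mem_cat ms' !inE eqxx !orbT.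
have perm_w : perm_eq w ((s ++ s') ++ (x ++ y ++ z)).
  by rewrite /w -/s' perm_catCA -catA perm_cat2l (catA x y (s' ++ z)) perm_catCA -catA.
have ba : (b == a) = false by rewrite eq_sym; apply: negbTE.
have av : a \notin map label (x ++ y ++ z).
  apply: (gauss_fresh gw perm_w).
  by rewrite /s'; case: (parallel); rewrite /= !labelE eqxx ba.
have bv : b \notin map label (x ++ y ++ z).
  apply: (gauss_fresh gw perm_w).
  by rewrite /s'; case: (parallel); rewrite /= !labelE eqxx (negbTE ab).
move: (av) (bv); rewrite !map_cat !mem_cat !negb_or.
move=> /and3P[ax ay az] /and3P[bx by_ bz].
set L := undup (map label (x ++ y ++ z)).
have aL : a \notin L by rewrite mem_undup.
have bL : b \notin L by rewrite mem_undup.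
rewrite (@alt_numberE _ (a :: b :: L)); first last.
- move=> i; rewrite !inE /L mem_undup !map_cat !mem_cat ms' !inE.
  by case: (i \in map label x); case: (i \in map label y);
    case: (i \in map label z); case: (i == a); case: (i == b).
- by rewrite /= inE negb_or ab aL bL undup_uniq.
have pab : sub_code a b w = s ++ s'.
  rewrite /w -/s' !sub_code_cat (sub_code_nil ax bx) (sub_code_nil ay by_)
    (sub_code_nil az bz) cats0 /=.
  rewrite /sub_code /s'.
  by case: (parallel); rewrite /= !labelE !eqxx ?orbT.
(* The two passages in [s] have the same level, while a counted pattern starts with passages of
   different levels. *)
have ab0 : alt_pair w a b = 0.
  rewrite /alt_pair pab /s' /s.
  by case: (parallel); rewrite /= /is_over /= eqxx !andbF.
have ba0 : alt_pair w b a = 0.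
  rewrite /alt_pair sub_codeC pab /s' /s.
  by case: (parallel); rewrite /= /is_over /= eqxx !andbF.
have abd d : d \in L ->
    alt_pair w b d = - alt_pair w a d /\ alt_pair w d b = - alt_pair w d a.
  move=> dL; have ad : a != d by apply: contraNneq aL => ->.
  have bd : b != d by apply: contraNneq bL => ->.
  rewrite /alt_pair 2!(sub_codeC d).
  have -> : sub_code b d w = map (swap_label a b) (sub_code a d w).
    have es : sub_code b d s = map (swap_label a b) (sub_code a d s).
      rewrite /sub_code /= !labelE !eqxx ba (negbTE ab) (negbTE ad) (negbTE bd) /=.
      by rewrite /swap_label labelE eqxx.
    have es' : sub_code b d s' = map (swap_label a b) (sub_code a d s').
      rewrite /s' /sub_code; case: (parallel);
      rewrite /= !labelE !eqxx ba (negbTE ab) (negbTE ad) (negbTE bd) /=;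
      by rewrite /swap_label labelE eqxx.
    rewrite /w -/s' !sub_code_cat !map_cat es es'.
    by rewrite (sub_code_swap _ ax bx) (sub_code_swap _ ay by_) (sub_code_swap _ az bz).
  apply: alt_pattern_swap => // _ /mapP[u + ->].
  by rewrite mem_filter !inE => /andP[].
(* Rows [a] and [b] cancel each other, then columns [a] and [b] cancel within each remaining row;
   the sum over [L] is left. *)
rewrite !big_cons ab0 ba0 !alt_pairxx !add0r addrA -big_split /=.
rewrite [X in X + _]big1_seq ?add0r; last by move=> d /andP[_ /abd[-> _]]; rewrite subrr.
apply: eq_big_seq => c cL.
rewrite !big_cons addrA (proj2 (abd c cL)) subrr add0r.
apply: eq_big_seq => d dL; rewrite /alt_pair; congr alt_pattern.
have sd u : {subset map label u <= [:: a; b]} -> sub_code c d u = [::].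
  move=> su; apply: sub_code_nil; apply/negP => /su; rewrite !inE => /orP[]/eqP E.
  - by rewrite E (negbTE aL) in cL.
  - by rewrite E (negbTE bL) in cL.
  - by rewrite E (negbTE aL) in dL.
  - by rewrite E (negbTE bL) in dL.
rewrite /w -/s' !sub_code_cat (sd s) // (sd s') // => i; rewrite ms' //.
Qed.

(** * Third Reidemeister move *)

Lemma triangle_alt_number e1 e2 e3 (s1 s2 s3 : gauss_code) :
  perm_eq [:: s1; s2; s3] (triangle 0 1 2 e1 e2 e3) ->
  alt_number (rev s1 ++ rev s2 ++ rev s3) = alt_number (s1 ++ s2 ++ s3).
Proof.
move=> P.
have /or3P H1 : [|| s1 == nth [::] (triangle 0 1 2 e1 e2 e3) 0,
  s1 == nth [::] (triangle 0 1 2 e1 e2 e3) 1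
  | s1 == nth [::] (triangle 0 1 2 e1 e2 e3) 2].
  by have := perm_mem P s1; rewrite !inE eqxx /= => /esym ->.
have /or3P H2 : [|| s2 == nth [::] (triangle 0 1 2 e1 e2 e3) 0,
  s2 == nth [::] (triangle 0 1 2 e1 e2 e3) 1
  | s2 == nth [::] (triangle 0 1 2 e1 e2 e3) 2].
  by have := perm_mem P s2; rewrite !inE eqxx orbT /= => /esym ->.
have /or3P H3 : [|| s3 == nth [::] (triangle 0 1 2 e1 e2 e3) 0,
  s3 == nth [::] (triangle 0 1 2 e1 e2 e3) 1
  | s3 == nth [::] (triangle 0 1 2 e1 e2 e3) 2].
  by have := perm_mem P s3; rewrite !inE eqxx !orbT /= => /esym ->.
(* Assignments of strands that are not permutations contradict [P]; the others are checked by
   evaluation for all signs. *)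
rewrite /alt_number !unlock.
case: H1 P => /eqP ->; case: H2 => /eqP ->; case: H3 => /eqP ->;
case: e1; case: e2; case: e3; vm_compute => //.
Qed.

Lemma triangle_relabel p q r e1 e2 e3 :
  triangle p q r e1 e2 e3 =
  map (relabel (nth 0%N [:: p; q; r])) (triangle 0 1 2 e1 e2 e3).
Proof. by case: e1; case: e2; case: e3. Qed.

Lemma triangle_alt_number_relabel p q r e1 e2 e3 (s1 s2 s3 : gauss_code) :
  uniq [:: p; q; r] -> perm_eq [:: s1; s2; s3] (triangle p q r e1 e2 e3) ->
  alt_number (rev s1 ++ rev s2 ++ rev s3) = alt_number (s1 ++ s2 ++ s3).
Proof.
move=> u; rewrite triangle_relabel; set f := nth _ _; set T := triangle _ _ _ _ _ _.
(* The reordering is recorded as a list of indices [Is], which also reorders the strands labelled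
   [0, 1, 2]. *)
case/(perm_iotaP [::]) => Is; rewrite size_map => PI e.
have P : perm_eq (map (nth [::] T) Is) T.
  by apply/(perm_iotaP [::]); exists Is.
have {}e : [:: s1; s2; s3] = map (relabel f) (map (nth [::] T) Is).
  rewrite e -map_comp; apply/eq_in_map => i.
  by rewrite (perm_mem PI) mem_iota leq0n add0n => iT; rewrite (nth_map [::]).
move: e P; case: (map _ Is) => [|t1 [|t2 [|t3 [|? ?]]]] //= [-> -> ->] P.
(* Only labels below 3 occur, and there [nth] on a list without repetition is injective. *)
have lt3 (v : gauss_code) : perm_eq v (flatten [:: t1; t2; t3]) ->
    {in map label v &, injective f}.
  move=> pv; have sub : {subset map label v <= iota 0 3}.
    move=> _ /mapP[y + ->]; rewrite (perm_mem pv) (perm_mem (perm_flatten P)).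
    move: y; apply/allP; rewrite /T.
    by case: (e1); case: (e2); case: (e3).
  move=> i j /sub + /sub; rewrite !mem_iota !leq0n !add0n => i3 j3 /eqP.
  by rewrite (@nth_uniq _ 0%N [:: p; q; r] i j i3 j3 u) => /eqP.
rewrite /relabel -!map_rev -!map_cat !alt_number_relabel ?(triangle_alt_number P) //.
  by apply: lt3; rewrite /= cats0.
by apply: lt3; rewrite /= cats0 !perm_cat // perm_rev.
Qed.

Lemma triangle_strand p q r e1 e2 e3 s : uniq [:: p; q; r] ->
  s \in triangle p q r e1 e2 e3 ->
  exists t t', [/\ s = [:: t; t'], label t \in [:: p; q; r],
                   label t' \in [:: p; q; r] & label t != label t'].
Proof.
rewrite /= !inE negb_or => /andP[/andP[pq pr] /andP[qr _]].
case/or3P => /eqP ->; rewrite /orient; case: ifP => _;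
  do 2!eexists; split; try reflexivity; rewrite ?inE !labelE ?eqxx ?orbT //;
  by rewrite eq_sym.
Qed.

(** Pairs inside the triangle are settled by the finite computation. If a crossing of the pair lies
    outside, each strand contains at most one passage of the pair, so reversing the strand leaves
    the restricted code unchanged. *)
Lemma alt_number_r3 (x y z u s1 s2 s3 : gauss_code) (p q r : nat) (e1 e2 e3 : bool) :
  let w := x ++ s1 ++ y ++ s2 ++ z ++ s3 ++ u in
  let w' := x ++ rev s1 ++ y ++ rev s2 ++ z ++ rev s3 ++ u in
  perm_eq [:: s1; s2; s3] (triangle p q r e1 e2 e3) ->
  gauss_word w -> alt_number w' = alt_number w.
Proof.
move=> w w' P gw; set S := s1 ++ s2 ++ s3; set S' := rev s1 ++ rev s2 ++ rev s3.
set V := x ++ y ++ z ++ u.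
have perm_w (v1 v2 v3 : gauss_code) :
    perm_eq (x ++ v1 ++ y ++ v2 ++ z ++ v3 ++ u) ((v1 ++ v2 ++ v3) ++ V).
  rewrite perm_catCA -!catA perm_cat2l (catA x y) perm_catCA perm_cat2l.
  by rewrite -!catA (catA x) (catA _ z) perm_catCA /V -!catA.
have PS : perm_eq S (flatten (triangle p q r e1 e2 e3)).
  by have := perm_flatten P; rewrite /= cats0.
have PS' : perm_eq S' S by rewrite !perm_cat ?perm_rev.
have cS i : count_mem i (map label S) = count_mem i [:: p; q; p; r; q; r].
  rewrite (permP (perm_map label PS)).
  by case: (e1); case: (e2); case: (e3);
  rewrite /= !labelE; case: (p == i); case: (q == i); case: (r == i).
have cS2 i : (count_mem i (map label S) <= 2)%N.
  have := gauss_count i gw; rewrite (permP (perm_map label (perm_w _ _ _))).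
  by rewrite map_cat count_cat; apply: leq_trans; rewrite leq_addr.
(* Any coincidence among [p], [q], [r] would give a label at least four occurrences. *)
have uK : uniq [:: p; q; r].
  have := cS2 p; have := cS2 q; rewrite !cS /= !eqxx.
  rewrite !inE !negb_or [q == p]eq_sym [r == p]eq_sym [r == q]eq_sym.
  by case: (p == q); case: (p == r); case: (q == r).

have notV i : i \in [:: p; q; r] -> i \notin map label V.
  move=> iK; apply: (gauss_fresh gw (perm_w _ _ _)); rewrite cS /=.
  move: iK; rewrite !inE [p == i]eq_sym [q == i]eq_sym [r == i]eq_sym.
  by case: (i == p); case: (i == q); case: (i == r).
set L := undup (map label V).
have uL : uniq ([:: p; q; r] ++ L).
  rewrite cat_uniq uK undup_uniq andbT; apply/hasPn => i /=; rewrite mem_undup => iV.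
  by apply: contraL iV; apply: notV.
have sL v : perm_eq v (S ++ V) -> {subset map label v <= [:: p; q; r] ++ L}.
  move=> Pv i; rewrite (perm_mem (perm_map label Pv)) map_cat !mem_cat mem_undup.
  case/orP => [iS|->]; last by rewrite orbT.
  move: iS; rewrite -has_pred1 has_count cS /= !inE.
  rewrite [p == i]eq_sym [q == i]eq_sym [r == i]eq_sym.
  by case: (i == p); case: (i == q); case: (i == r).
have pw : perm_eq w (S ++ V) by apply: perm_w.
have pw' : perm_eq w' (S ++ V).
  by apply: perm_trans (perm_w _ _ _) _; rewrite perm_cat2r.
have inK i j : i \in [:: p; q; r] -> j \in [:: p; q; r] ->
    alt_pair w' i j = alt_pair S' i j /\ alt_pair w i j = alt_pair S i j.
  move=> /notV + /notV; rewrite !map_cat !mem_cat !negb_or.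
  move=> /and4P[ix iy iz iu] /and4P[jx jy jz ju].
  rewrite /alt_pair /w /w' /S /S' !sub_code_cat (sub_code_nil ix jx).
  by rewrite (sub_code_nil iy jy) (sub_code_nil iz jz) (sub_code_nil iu ju) /= !cats0.
have outK i j : (i \notin [:: p; q; r]) || (j \notin [:: p; q; r]) ->
    alt_pair w' i j = alt_pair w i j.
  move=> ij.
  have rs s : s \in [:: s1; s2; s3] -> sub_code i j (rev s) = sub_code i j s.
    rewrite (perm_mem P) => sT.
    have [t [t' [-> tK tK' tt']]] : exists t t', [/\ s = [:: t; t'],
        label t \in [:: p; q; r], label t' \in [:: p; q; r] & label t != label t'].
      exact: triangle_strand uK sT.
    have : (size (sub_code i j [:: t; t']) <= 1)%N.
      rewrite /sub_code /=; have [ti|//] := boolP (_ || _); last by case: ifP.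
      have [ti'|//] := boolP (_ || _).
      by case/orP: ti' tt' tK' => /eqP ->; case/orP: ti tK => /eqP -> tK tt' tK';
        move: tt' ij; rewrite ?tK ?tK' ?eqxx.
    rewrite /sub_code filter_rev; case: [seq _ <- _ | _] => [|? []] //.
  rewrite /alt_pair /w /w' !sub_code_cat !rs // !inE eqxx ?orbT //.
have sum v : perm_eq v (S ++ V) -> alt_number v =
    \sum_(i <- [:: p; q; r]) \sum_(j <- [:: p; q; r]) alt_pair v i j +
    (\sum_(i <- [:: p; q; r]) \sum_(j <- L) alt_pair v i j +
     \sum_(i <- L) \sum_(j <- [:: p; q; r] ++ L) alt_pair v i j).
  move=> pv; rewrite (alt_numberE uL (sL _ pv)) big_cat addrA; congr (_ + _).
  by rewrite -big_split; apply: eq_bigr => k _; rewrite big_cat.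
rewrite !sum //; congr (_ + (_ + _)).
- have K v : perm_eq v S -> \sum_(i <- [:: p; q; r]) \sum_(j <- [:: p; q; r])
      alt_pair v i j = alt_number v.
    move=> pv; rewrite -alt_numberE // => k; rewrite (perm_mem (perm_map label pv)).
    rewrite -has_pred1 has_count cS /= !inE.
    rewrite [p == k]eq_sym [q == k]eq_sym [r == k]eq_sym.
    by case: (k == p); case: (k == q); case: (k == r).
  have := triangle_alt_number_relabel uK P; rewrite -/S -/S' -(K S') // -(K S) //.
  move=> e.
  transitivity (\sum_(i <- [:: p; q; r]) \sum_(j <- [:: p; q; r]) alt_pair S' i j).
    by apply: eq_big_seq => i iK; apply: eq_big_seq => j /(inK i _ iK)[].
  rewrite e; apply/esym.
  by apply: eq_big_seq => i iK; apply: eq_big_seq => j /(inK i _ iK)[].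
- apply: eq_bigr => k _; apply: eq_big_seq => l lL; apply: outK.
  have := uL; rewrite cat_uniq => /and3P[_ /hasPn/(_ _ lL) -> _].
  by rewrite orbT.
- apply: eq_big_seq => k kL; apply: eq_bigr => l _; apply: outK.
  by have := uL; rewrite cat_uniq => /and3P[_ /hasPn/(_ _ kL) -> _].
Qed.

(** * Invariance on knotoids and the value on [k2.1] *)

Lemma alt_number_equiv (D D' : knotoid_diagram) : knotoid_equiv D D' ->
  alt_number (sval D) = alt_number (sval D').
Proof.
elim=> {D D'} [D D' r | // | D D' _ -> // | D D' D'' _ -> _ -> //].
(* The relation links knotoid diagrams, so both codes are Gauss words; the first two moves use this
   for the larger code. *)
have gw (E : knotoid_diagram) : gauss_word (sval E) by case: E => w /= /andP[].
move: r (gw D) (gw D'); case: (sval D) (sval D') / => [f w fI _ _|x y a o e _ g||].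
- by rewrite alt_number_relabel // => a b _ _; apply: fI.
- by rewrite alt_number_r1.
- by move=> x y z a b o e pl s _ g; rewrite alt_number_r2.
- by move=> x y z u s1 s2 s3 p q r e1 e2 e3 P g _; rewrite (alt_number_r3 P g).
Qed.

Lemma alt_number_standard (a b : nat) (o e : bool) : a != b ->
  alt_number [:: (a, o, e); (b, ~~ o, e); (a, ~~ o, e); (b, o, e)] = 1.
Proof.
move=> ab; set w := (X in alt_number X).
pose f i := if i == 0%N then a else b.
have -> : w = relabel f [:: (0, o, e); (1, ~~ o, e); (0, ~~ o, e); (1, o, e)]%N by [].
rewrite alt_number_relabel.
  by rewrite /alt_number unlock; case: o @w; case: e; vm_compute.
move=> i j; rewrite !inE /f => /or4P[]/eqP -> /or4P[]/eqP -> //= /eqP;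
  by rewrite ?(negbTE ab) // eq_sym (negbTE ab).
Qed.

Lemma is_k2_1_alt_number (D : knotoid_diagram) : is_k2_1 D ->
  alt_number (sval D) = 1.
Proof.
case=> D0 [a [b [ov [e [ab eD0]]]]] /alt_number_equiv ->.
by rewrite eD0 alt_number_standard.
Qed.

(** * Gauss codes and alternating sums *)

Lemma double_pointC (R : realType) (g : R -> 'rV[R]_3) xi s t :
  double_point g xi s t -> double_point g xi t s.
Proof. by case=> s01 t01 st e; split => //; rewrite eq_sym. Qed.

Lemma overC (R : realType) (g : R -> 'rV[R]_3) xi s t :
  generic g xi -> double_point g xi s t -> over g xi t s = ~~ over g xi s t.
Proof.
by move=> [_ _ G] /G[_ _ h _]; rewrite /over -leNgt le_eqVlt (negbTE h).
Qed.

Lemma crossing_signC (R : realType) (g : R -> 'rV[R]_3) xi s t :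
  generic g xi -> double_point g xi s t ->
  crossing_sign g xi t s = crossing_sign g xi s t.
Proof. by move=> G st; rewrite /crossing_sign (overC G st); case: over. Qed.

(** Passages are indexed by parameter values rather than by ranks, which matches the form of
    [alternating_pairs]. *)
Lemma is_gauss_codeP (R : realType) (g : R -> 'rV[R]_3) xi w :
  is_gauss_code g xi w <-> exists (ts : seq R) (code : R -> passage),
    [/\ sorted <%R ts, (forall t, (t \in ts) <-> exists s, double_point g xi t s),
        w = map code ts &
        forall s t, s \in ts -> t \in ts -> s != t ->
          (label (code s) = label (code t) <-> double_point g xi s t) /\
          (double_point g xi s t ->
             is_over (code s) = over g xi s t /\
             is_pos (code s) = (0 < crossing_sign g xi s t))].
Proof.
split=> [[ts [st mem_ts sz H]]|[ts [code [st mem_ts -> H]]]].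
  have uts : uniq ts by apply: sorted_uniq st; [exact: lt_trans|exact: ltxx].
  exists ts, (fun t => nth (0%N, false, false) w (index t ts)); split => //.
    apply: (@eq_from_nth _ (0%N, false, false)); rewrite ?size_map // => i.
    by rewrite sz => iw; rewrite (nth_map 0) // index_uniq.
  move=> s t sts tts neq; have := H (index s ts) (index t ts).
  rewrite /= !index_mem !nth_index //; apply => //.
  by apply: contraNneq neq => /(congr1 (nth 0 ts)); rewrite !nth_index // => ->.
exists ts; split; rewrite ?size_map // => i j its jts ij x t.
have uts : uniq ts by apply: sorted_uniq st; [exact: lt_trans|exact: ltxx].
rewrite /x !(nth_map 0) //; apply: H; rewrite ?mem_nth //.
by rewrite nth_uniq.
Qed.

(** Genericity makes the determinant nonzero, so the sign is 1 or -1 and is determined by its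
    positivity. *)
Lemma sgn_crossing_sign (R : realType) (g : R -> 'rV[R]_3) xi s t (x : passage) :
  generic g xi -> double_point g xi s t ->
  is_pos x = (0 < crossing_sign g xi s t) -> (sgn x)%:~R = crossing_sign g xi s t.
Proof.
move=> G st; rewrite /sgn => ->; have [_ _ _ d0] := (let: And3 _ _ H := G in H _ _ st).
have [_ _ _ d0'] := (let: And3 _ _ H := G in H _ _ (double_pointC st)).
rewrite /crossing_sign; case: over; rewrite sgr_gt0.
  by case: sgrP d0; rewrite ?eqxx //.
by case: sgrP d0'; rewrite ?eqxx //.
Qed.

(** The tuples of [alternating_pairs] correspond one-to-one to the ordered label pairs with nonzero
    contribution, and the terms agree. *)
Lemma alternating_sum_alt_number (R : realType) (g : R -> 'rV[R]_3) xi w :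
  generic g xi -> is_gauss_code g xi w -> alternating_sum g xi = (alt_number w)%:~R.
Proof.
move=> G /is_gauss_codeP[ts [code [st mem_ts ew H]]].
have dmem s t : double_point g xi s t -> s \in ts /\ t \in ts.
  by move=> d; split; apply/mem_ts; [exists t|exists s; apply: double_pointC].
have dneq s t : double_point g xi s t -> s != t by case.
have duniq s t u : double_point g xi s t -> double_point g xi s u -> t = u.
  by move=> d d'; case: G => _ U _; apply: U d d'.
have Hl s t : double_point g xi s t -> label (code s) = label (code t).
  move=> d; have [m1 m2] := dmem _ _ d.
  exact: (proj2 (proj1 (H s t m1 m2 (dneq _ _ d))) d).
have Hd s t : s \in ts -> t \in ts -> s != t -> label (code s) = label (code t) ->
    double_point g xi s t by move=> m1 m2 st'; apply: (proj1 (proj1 (H s t m1 m2 st'))).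
have Ho s t : double_point g xi s t -> is_over (code s) = over g xi s t.
  move=> d; have [m1 m2] := dmem _ _ d.
  by have [_ /(_ d)[]] := H s t m1 m2 (dneq _ _ d).
have Hs s t : double_point g xi s t -> (sgn (code s))%:~R = crossing_sign g xi s t.
  move=> d; have [m1 m2] := dmem _ _ d; apply: sgn_crossing_sign => //.
  by have [_ /(_ d)[]] := H s t m1 m2 (dneq _ _ d).
set T := alternating_pairs g xi.
(* Tuples are decreasing while codes are read in increasing order: the first two passages read are
   [j4] and [j3], the last components. *)
pose lab (j : R * R * R * R) := (label (code j.2), label (code j.1.2)).
have sub_codeE a b : sub_code a b w =
    map code [seq t <- ts | (label (code t) == a) || (label (code t) == b)].
  by rewrite /sub_code ew filter_map.
have labT j : T j -> alt_pair w (lab j).1 (lab j).2 =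
    sgn (code j.2) * sgn (code j.1.2) /\
    [seq t <- ts | (label (code t) == (lab j).1) || (label (code t) == (lab j).2)] =
    [:: j.2; j.1.2; j.1.1.2; j.1.1.1].
  case: j => [[[j1 j2] j3] j4] [[j21 j32 j43] d13 d24 alt] /=.
  have [m1 m3] := dmem _ _ d13; have [m2 m4] := dmem _ _ d24.
  have d31 := double_pointC d13; have d42 := double_pointC d24.
  have e : [seq t <- ts | (label (code t) == label (code j4))
               || (label (code t) == label (code j3))] = [:: j4; j3; j2; j1].
    apply: lt_sorted_eq; first by apply: sorted_filter => //; apply: lt_trans.
      by rewrite /= j21 j32 j43.
    have close a b t : double_point g xi a b -> t \in ts ->
        (label (code t) == label (code a)) = (t == a) || (t == b).
      move=> d tts; have [ma mb] := dmem _ _ d.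
      have [->|ta] := eqVneq t a; first by rewrite eqxx.
      apply/eqP/eqP => [l|->]; last by rewrite (Hl _ _ d).
      by apply: (duniq a) => //; apply/double_pointC/Hd.
    move=> t; rewrite mem_filter !inE.
    have [tts|/negP tts] := boolP (t \in ts); last first.
      rewrite andbF; apply/esym/negbTE/negP => /or4P[]/eqP e; apply: tts; by rewrite e.
    rewrite andbT (close _ _ _ d42) // (close _ _ _ d31) //.
    by case: (t == j1); case: (t == j2); case: (t == j3); case: (t == j4).
  have l34 : label (code j4) != label (code j3).
    apply: contraTneq j32 => l; have := Hd _ _ m4 m3 _ l.
    rewrite lt_eqF ?(lt_trans j32) // => /(_ isT) d43.
    by rewrite (duniq _ _ _ d42 d43) ltxx.
  split => //; rewrite /alt_pair sub_codeE e /=.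
  rewrite l34 (Hl _ _ d42) (Hl _ _ d13) !eqxx /=.
  rewrite (Ho _ _ d42) (Ho _ _ d31) (Ho _ _ d24) (Ho _ _ d13).
  rewrite (overC G d24) (overC G d13).
  by case: alt => -[]; rewrite ?(overC G d24) ?(overC G d13);
    case: (over g xi j1 j3); case: (over g xi j2 j4).
(* The labels determine the filtered list of parameters, hence the tuple. *)
have labI : {in T &, injective lab}.
  move=> j k; rewrite !inE => /labT[_ ej] /labT[_ ek] e; move: ej.
  rewrite e ek; case: j {e} => [[[j1 j2] j3] j4].
  by case: k {ek} => [[[k1 k2] k3] k4] /= [-> -> -> ->].
have labS a b : alt_pair w a b != 0 -> exists2 j, T j & lab j = (a, b).
  move=> /alt_pattern_neq0; rewrite sub_codeE.
  set us := [seq _ <- _ | _]; move=> [x1 [x2 [x3 [x4 [e ab l o _]]]]].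
  have us_ts t : t \in us -> t \in ts by rewrite mem_filter => /andP[].
  have : sorted <%R us by apply: sorted_filter => //; apply: lt_trans.
  move: us us_ts e l o => [|t1 [|t2 [|t3 [|t4 [|? ?]]]]] //= us_ts [<- <- <- <-].
  move=> [l1 l2 l3 l4] [h12 h13 h24] /and4P[t12 t23 t34 _].
  have d13 : double_point g xi t1 t3.
    apply: Hd; rewrite ?us_ts ?inE ?eqxx ?orbT ?l1 ?l3 //.
    by rewrite lt_eqF // (lt_trans t12).
  have d24 : double_point g xi t2 t4.
    apply: Hd; rewrite ?us_ts ?inE ?eqxx ?orbT ?l2 ?l4 //.
    by rewrite lt_eqF // (lt_trans t23).
  exists (t4, t3, t2, t1); rewrite /lab /= ?l1 ?l2 //.
  split; [by []|exact: double_pointC|exact: double_pointC|].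
  move: h12 h13 h24; rewrite (Ho _ _ d13) (Ho _ _ d24) (Ho _ _ (double_pointC d13)).
  rewrite (Ho _ _ (double_pointC d24)) (overC G d13) (overC G d24).
  by case: (over g xi t1 t3); case: (over g xi t2 t4) => // _ _ _; [left|right].
(* [T] lies in the fourth power of the finite list [ts]; finiteness turns the sum over a set into a
   sum over a list. *)
have finT : finite_set T.
  apply: (@sub_finite_set _ _ ([set` ts] `*` [set` ts] `*` [set` ts] `*` [set` ts])).
    move=> [[[j1 j2] j3] j4] [_ /dmem[m1 m3] /dmem[m2 m4] _]; do !split => //.
  by do !apply: finite_setX; apply: finite_seq.
rewrite /alternating_sum fsbig_finite //= -/T.
transitivity (\sum_(j <- fset_set T) (alt_pair w (lab j).1 (lab j).2)%:~R : R).
  apply: eq_big_seq => j; rewrite in_fset_set // inE => Tj.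
  rewrite (proj1 (labT _ Tj)).
  case: j Tj => [[[j1 j2] j3] j4] [_ d13 d24 _] /=.
  rewrite rmorphM /= (Hs _ _ (double_pointC d13)) (Hs _ _ (double_pointC d24)).
  rewrite (crossing_signC G d13) (crossing_signC G d24); exact: mulrC.
set L := undup (map label w).
have eL : alt_number w = \sum_(q <- [seq (a, b) | a <- L, b <- L]) alt_pair w q.1 q.2.
  by rewrite big_allpairs.
rewrite eL rmorph_sum /= -(big_map lab predT (fun q => (alt_pair w q.1 q.2)%:~R)) /=.
(* Label pairs outside the image of [lab] contribute zero. *)
apply/esym/sum_uniq_support.
- by rewrite allpairs_uniq ?undup_uniq // => [[? ?] [? ?]].
- rewrite map_inj_in_uniq ?fset_uniq // => j k; rewrite !in_fset_set //; exact: labI.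
- move=> _ /mapP[j + ->]; rewrite in_fset_set // inE.
  case: j => [[[j1 j2] j3] j4] [_ /dmem[m1 m3] /dmem[m2 m4] _].
  by apply: allpairs_f; rewrite mem_undup ew -map_comp; apply/mapP; [exists j4|exists j3].
- move=> [a b] /= nin; apply/eqP; rewrite intr_eq0; apply: contraNT nin.
  case/labS => j Tj <-; apply: map_f; rewrite in_fset_set //; exact: mem_set.
Qed.

(** * Construction of a Gauss code from a list of crossings *)

Lemma find_crossing (T : eqType) (cs : seq (T * T)) (x0 : T * T) i t :
  uniq (flatten [seq [:: c.1; c.2] | c <- cs]) -> (i < size cs)%N ->
  t \in [:: (nth x0 cs i).1; (nth x0 cs i).2] ->
  find (fun c => t \in [:: c.1; c.2]) cs = i.
Proof.
elim: cs i => //= c cs IH [|i] /=; first by move=> _ _ ->.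
rewrite inE negb_or => /and3P[/andP[_ c1] c2 u] ics tc.
have tf : t \in flatten [seq [:: c.1; c.2] | c <- cs].
  by apply/flatten_mapP; exists (nth x0 cs i) => //; apply: mem_nth.
rewrite ifN ?(IH i) // !inE negb_or.
by apply/andP; split; [apply: contraNneq c1|apply: contraNneq c2] => <-.
Qed.

(** The label of a passage is the rank of its crossing in [cs], so curves with few crossings get
    explicit codes on the labels [0, 1, 2]. *)
Lemma gauss_code_of_crossings (R : realType) (g : R -> 'rV[R]_3) xi
    (cs : seq (R * R)) (ts : seq R) :
  generic g xi ->
  (forall s t, double_point g xi s t <-> (s, t) \in cs \/ (t, s) \in cs) ->
  sorted <%R ts -> perm_eq ts (flatten [seq [:: c.1; c.2] | c <- cs]) ->
  exists2 code : R -> passage, is_gauss_code g xi (map code ts) &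
    forall i, (i < size cs)%N -> let c := nth (0, 0) cs i in
      code c.1 = (i, over g xi c.1 c.2, 0 < crossing_sign g xi c.1 c.2) /\
      code c.2 = (i, ~~ over g xi c.1 c.2, 0 < crossing_sign g xi c.1 c.2).
Proof.
move=> G D st pts.
have uts : uniq ts by apply: sorted_uniq st; [exact: lt_trans|exact: ltxx].
have ufl : uniq (flatten [seq [:: c.1; c.2] | c <- cs]) by rewrite -(perm_uniq pts).
pose idx t := find (fun c : R * R => t \in [:: c.1; c.2]) cs.
(* The exclusive or returns the level of [c.1] at [c.1] and the opposite level at [c.2]. *)
pose code t : passage := let c := nth (0, 0) cs (idx t) in
  (idx t, (t == c.1) (+) ~~ over g xi c.1 c.2, 0 < crossing_sign g xi c.1 c.2).
have cneq c : c \in cs -> (c.2 == c.1) = false.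
  move=> cc; rewrite eq_sym; apply: negbTE.
  by have [] : double_point g xi c.1 c.2 by apply/D; left; case: c cc.
have codeE i : (i < size cs)%N -> let c := nth (0, 0) cs i in
    code c.1 = (i, over g xi c.1 c.2, 0 < crossing_sign g xi c.1 c.2) /\
    code c.2 = (i, ~~ over g xi c.1 c.2, 0 < crossing_sign g xi c.1 c.2).
  move=> ics c; have i1 : idx c.1 = i.
    by apply: (find_crossing (x0 := (0, 0)) ufl ics); rewrite inE eqxx.
  have i2 : idx c.2 = i.
    by apply: (find_crossing (x0 := (0, 0)) ufl ics); rewrite !inE eqxx orbT.
  rewrite /code i1 i2 -/c eqxx cneq; last exact: mem_nth.
  by rewrite addTb negbK.
clearbody code; exists code; last exact: codeE.
apply/is_gauss_codeP; exists ts, code; split; [exact: st| |by []|].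
  move=> t; rewrite (perm_mem pts); split.
    case/flatten_mapP => -[s u] cc; rewrite !inE /= => /orP[]/eqP ->.
      by exists u; apply/D; left.
    by exists s; apply/D; right.
  case=> s /D[] cc; apply/flatten_mapP; first by exists (t, s); rewrite // !inE eqxx.
  by exists (s, t); rewrite // !inE eqxx orbT.
move=> s t sts tts neq.
have {codeE} cE c : c \in cs ->
    code c.1 = (index c cs, over g xi c.1 c.2, 0 < crossing_sign g xi c.1 c.2) /\
    code c.2 = (index c cs, ~~ over g xi c.1 c.2, 0 < crossing_sign g xi c.1 c.2).
  move=> cc; have ics : (index c cs < size cs)%N by rewrite index_mem.
  by have := codeE _ ics; rewrite (nth_index (0, 0) cc); apply.
split; last first.
  move=> d; move/D: (d) => [] /cE [/= ci1 ci2].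
    by rewrite ci1 is_overE is_posE; split; reflexivity.
  rewrite ci2 is_overE is_posE (overC G d) negbK.
  by rewrite (crossing_signC G d); split; reflexivity.
split=> [l|/D[]/cE/=[-> ->] //].
move: sts tts; rewrite !(perm_mem pts).
move=> /flatten_mapP[c cc sc] /flatten_mapP[c' cc' tc'].
have lc : label (code s) = index c cs.
  by have [e1 e2] := cE _ cc; move: sc; rewrite !inE => /orP[]/eqP ->; rewrite ?e1 ?e2.
have lc' : label (code t) = index c' cs.
  by have [e1 e2] := cE _ cc'; move: tc'; rewrite !inE => /orP[]/eqP ->; rewrite ?e1 ?e2.
have ecc : c' = c by rewrite -(nth_index (0, 0) cc) -lc l lc' nth_index.
move: sc tc' neq; rewrite ecc !inE => /orP[]/eqP -> /orP[]/eqP ->; rewrite ?eqxx // => _.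
  by apply/D; left; case: (c) cc.
by apply/D; right; case: (c) cc.
Qed.

(** * Geometry of polygonal curves *)

Lemma det3E (R : realType) (u v w : 'rV[R]_3) :
  det3 u v w = u 0 0 * (v 0 1 * w 0 2 - v 0 2 * w 0 1)
             - u 0 1 * (v 0 0 * w 0 2 - v 0 2 * w 0 0)
             + u 0 2 * (v 0 0 * w 0 1 - v 0 1 * w 0 0).
Proof.
(* Reading entries through natural numbers identifies equal ordinals that are written differently,
   so that [ring] sees the same atoms. *)
have [c cE] : exists c : 'rV[R]_3 -> nat -> R, 
    forall (a : 'rV[R]_3) i, a 0 i = c a (nat_of_ord i).
  exists (fun (a : 'rV[R]_3) i => a 0 (inord i)) => a i; congr (fun_of_matrix _ _ _).
  by apply/val_inj; rewrite /= inordK.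
rewrite /det3 (expand_det_row _ ord0) !big_ord_recl big_ord0 addr0.
rewrite /cofactor !(expand_det_row _ ord0) !big_ord_recl !big_ord0 /cofactor !det_mx11.
by rewrite !mxE /= !cE /= /bump /=; ring.
Qed.

Lemma det3C (R : realType) (u v w : 'rV[R]_3) : det3 v u w = - det3 u v w.
Proof. by rewrite !det3E; ring. Qed.

Lemma det3_diag13 (R : realType) (u v : 'rV[R]_3) : det3 u v u = 0.
Proof. by rewrite !det3E; ring. Qed.

Lemma det3Zl (R : realType) (a : R) (u v w : 'rV[R]_3) :
  det3 (a *: u) v w = a * det3 u v w.
Proof. by rewrite !det3E !mxE; ring. Qed.

Lemma det3Zr (R : realType) (a : R) (u v w : 'rV[R]_3) :
  det3 u (a *: v) w = a * det3 u v w.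
Proof. by rewrite det3C det3Zl det3C mulrN opprK. Qed.

Lemma det3_diag12 (R : realType) (u v : 'rV[R]_3) : det3 u u v = 0.
Proof. by rewrite !det3E; ring. Qed.

(** The functional [det3 _ z xi] is linear and kills [xi]: a relation between vectors modulo [xi]
    becomes a scalar relation between oriented areas in the projection. *)
Lemma det3_dependent (R : realType) (a b c h : R) (u v w xi : 'rV[R]_3) :
  a *: u + b *: v + c *: w = h *: xi -> forall z,
  a * det3 u z xi + b * det3 v z xi + c * det3 w z xi = 0.
Proof.
move=> e z; have <- : det3 (h *: xi) z xi = 0 by rewrite det3Zl det3_diag13 mulr0.
by rewrite -e !det3E !mxE; ring.
Qed.

Lemma dot_linear (R : realType) (a : R) (u v w : 'rV[R]_3) :
  dot (a *: u + v) w = a * dot u w + dot v w.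
Proof.
rewrite /dot mulr_sumr -big_split; apply: eq_bigr => i _.
by rewrite !mxE mulrDl mulrA.
Qed.

Lemma dotB (R : realType) (u v w : 'rV[R]_3) : dot (u - v) w = dot u w - dot v w.
Proof. by rewrite -scaleN1r addrC dot_linear mulN1r addrC. Qed.

Lemma dotZ (R : realType) (a : R) (u w : 'rV[R]_3) : dot (a *: u) w = a * dot u w.
Proof.
rewrite -[a *: u]subr0 dot_linear [dot (- 0) w]big1 ?addr0 // => i _.
by rewrite !mxE oppr0 mul0r.
Qed.

Lemma projP (R : realType) (xi x y : 'rV[R]_3) :
  proj xi x = proj xi y <-> x - y = (dot x xi - dot y xi) *: xi.
Proof.
by rewrite /proj; split => e; apply/rowP => i;
  have := congr1 (fun m : 'rV_3 => m 0 i) e; rewrite !mxE; lra.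
Qed.

(** * One-sided derivatives and the edges of the curve *)

Lemma derive1_one_sided (R : realType) (V : normedModType R) (g : R -> V) s v
    (F : set_system R) : ProperFilter F -> F --> 0^' ->
  derivable g s 1 -> (\forall h \near F, g (h + s) - g s = h *: v) ->
  derive1 g s = v.
Proof.
move=> FF F0 dg near_v; rewrite derive1E.
have c : h^-1 *: (g (h *: 1 + s) - g s) @[h --> F] --> 'D_1 g s.
  by apply: cvg_trans dg; apply: cvg_app.
have neq0 : \forall h \near (0 : R)^', h != 0 by exact: nbhs_dnbhs_neq.
have c' : h^-1 *: (g (h *: 1 + s) - g s) @[h --> F] --> v.
  apply: cvg_near_cst; near=> h.
  rewrite (_ : h *: 1 = h); last exact: mulr1.
  have -> : g (h + s) - g s = h *: v by near: h.
  have h0 : h != 0 by near: h; exact: (F0 _ neq0).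
  by rewrite scalerA mulVf // scale1r.
exact: cvg_unique c c'.
Unshelve. all: by end_near.
Qed.

Definition edge (R : realType) (n : nat) (p : 'I_n.+1 -> 'rV[R]_3) (k : nat) : 'rV[R]_3 :=
  p (inord k.+1) - p (inord k).

(** The clamped coefficients are 1 before edge [k] and 0 after it, so the sum telescopes to the
    vertex at the start of edge [k]. The interval is closed: at an interior vertex the formulas of
    both edges apply. *)
Lemma polygonal_curve_edge (R : realType) (n : nat) (p : 'I_n.+1 -> 'rV[R]_3) k t :
  (k < n)%N -> k%:R <= n%:R * t <= k.+1%:R ->
  polygonal_curve p t =
  p (inord k) + (n%:R * t - k%:R) *: edge p k.
Proof.
move=> kn /andP[kt tk]; rewrite /polygonal_curve /edge.
pose c (i : nat) := Num.min 1 (Num.max 0 (n%:R * t - i%:R)).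
rewrite (eq_bigr (fun i : 'I_n => c i *: (p (inord i.+1) - p (inord i)))); last first.
  move=> i _; congr (_ *: (p _ - p _)); apply/val_inj; rewrite /= inordK //.
    by rewrite ltnS.
  by rewrite ltnW // ltnS.
rewrite -(big_mkord xpredT (fun i => c i *: (p (inord i.+1) - p (inord i)))).
rewrite (big_cat_nat (n := k)) ?(ltnW kn) //= [X in _ + (_ + X)]big_ltn //.
rewrite [X in _ + (_ + (_ + X))]big_nat [X in _ + (_ + (_ + X))]big1 ?addr0; last first.
  move=> i /andP[ki _]; rewrite /c max_l; first by rewrite min_r ?scale0r.
  by rewrite subr_le0 (le_trans tk) // ler_nat.
have -> : c k = n%:R * t - k%:R.
  by rewrite /c max_r ?subr_ge0 // min_r // lerBlDr addrC natr1.
rewrite addrA; congr (_ + _).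
rewrite (eq_big_nat _ _ (F2 := fun i => p (inord i.+1) - p (inord i))); last first.
  move=> i /andP[_ ik]; rewrite /c max_r ?subr_ge0; last first.
    by rewrite (le_trans _ kt) // ler_nat ltnW.
  rewrite min_l ?scale1r // lerBrDr addrC natr1 (le_trans _ kt) // ler_nat //.
rewrite telescope_sumr // addrC.
have -> : inord 0 = ord0 :> 'I_n.+1 by apply/val_inj; rewrite /= inordK.
by rewrite subrK.
Qed.

(* A double point may lie at a vertex where the curve goes straight on; it is
   then attributed to the outgoing edge. *)
Definition on_edge (R : realType) (n : nat) (p : 'I_n.+1 -> 'rV[R]_3) (k : nat) (s : R) :=
  [/\ k%:R <= n%:R * s < k.+1%:R,
      derive1 (polygonal_curve p) s = n%:R *: edge p k &
      n%:R * s = k%:R -> (0 < k)%N /\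
        edge p k.-1 = edge p k].

(** [k] is the integer part of [n s]. The right derivative is read on edge [k]; at a vertex,
    derivability forces the left derivative, read on edge [k - 1], to agree with it. *)
Lemma on_edge_exists (R : realType) (n : nat) (p : 'I_n.+1 -> 'rV[R]_3) s :
  (0 < n)%N -> 0 < s < 1 -> derivable (polygonal_curve p) s 1 ->
  exists2 k, (k < n)%N & on_edge p k s.
Proof.
move=> n0 /andP[s0 s1] dg; set g := polygonal_curve p in dg *.
have n0' : 0 < n%:R :> R by rewrite ltr0n.
have ns0 : 0 <= n%:R * s by rewrite mulr_ge0 ?ltW.
pose k := Num.truncn (n%:R * s).
have /andP[ks sk] : k%:R <= n%:R * s < k.+1%:R by apply: truncn_itv.
have kn : (k < n)%N.
  by rewrite -(ltr_nat R) (le_lt_trans ks) // gtr_pMr.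
have right_k : derive1 g s = n%:R *: edge p k.
  apply: (@derive1_one_sided _ _ _ _ _ (0^'+)) => //.
    by apply: within_subset; move=> h /= h0; rewrite gt_eqF.
  near=> h.
  have h0 : 0 < h by near: h; exact: nbhs_right_gt.
  (* Such an [h] keeps [h + s] on edge [k]. *)
  have hk : h < (k.+1%:R - n%:R * s) / n%:R.
    by near: h; apply: nbhs_right_lt; rewrite divr_gt0 // subr_gt0.
  rewrite ltr_pdivlMr // in hk.
  rewrite /g !(@polygonal_curve_edge _ _ _ k) //.
  - by rewrite opprD addrACA subrr add0r -scalerBl scalerA; congr (_ *: _); ring.
  - by rewrite ks ltW.
  - by apply/andP; split; nra.
exists k => //; split; rewrite ?ks // => nsk.
have k0 : (0 < k)%N by rewrite -(ltr_nat R) -nsk mulr_gt0.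
have [j kE] : exists j, k = j.+1 by exists k.-1; rewrite prednK.
split => //; apply: (@scalerI _ _ n%:R); first by rewrite gt_eqF.
rewrite -right_k; apply/esym.
apply: (@derive1_one_sided _ _ _ _ _ (0^'-)) => //.
  by apply: within_subset; move=> h /= h0; rewrite lt_eqF.
near=> h.
have h0 : h < 0 by near: h; exact: nbhs_left_lt.
(* Moving back by less than [1 / n] stays on the previous edge. *)
have hk : - n%:R^-1 < h.
  by near: h; apply: nbhs_left_gt; rewrite oppr_lt0 invr_gt0.
have nh : -1 < h * n%:R by rewrite -ltr_pdivrMr // mulN1r.
rewrite kE /= -/g; rewrite kE -natr1 in nsk.
rewrite /g !(@polygonal_curve_edge _ _ _ j).
- by rewrite opprD addrACA subrr add0r -scalerBl scalerA; congr (_ *: _); ring.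
- by rewrite -ltnS -kE ltnW.
- by rewrite nsk -natr1 lexx andbT lerDl.
- by rewrite -ltnS -kE ltnW.
- by rewrite -natr1; apply/andP; split; nra.
Unshelve. all: by end_near.
Qed.

Lemma on_edgeE (R : realType) (n : nat) (p : 'I_n.+1 -> 'rV[R]_3) k s :
  (k < n)%N -> on_edge p k s ->
  polygonal_curve p s = p (inord k) + (n%:R * s - k%:R) *: edge p k.
Proof.
by move=> kn [/andP[ks sk] _ _]; rewrite (polygonal_curve_edge _ kn) // ks ltW.
Qed.

Lemma vertexS (R : realType) (n : nat) (p : 'I_n.+1 -> 'rV[R]_3) k :
  p (inord k.+1) = p (inord k) + edge p k.
Proof. by rewrite addrC subrK. Qed.

(** The second weight may vanish a priori because edges are half-open; [b = 0] would force
    [x = 0]. *)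
Lemma opposite_signs (R : realType) (a b x y : R) : 0 < a -> 0 <= b ->
  x != 0 -> y != 0 -> a * x + b * y = 0 -> (0 < x) = ~~ (0 < y).
Proof.
move=> a0 b0 x0 y0 e; rewrite -leNgt le_eqVlt (negbTE y0) /=.
by apply/idP/idP => xy; rewrite ltNge; apply/negP => yx; case/negP: x0; apply/eqP; nra.
Qed.

Lemma positive_combination_gt0 (R : realType) (a b x y : R) : 0 < a -> 0 < b ->
  x != 0 -> y != 0 -> (0 < x) = (0 < y) -> (0 < a * x + b * y) = (0 < x).
Proof.
move=> a0 b0; case: (ltgtP 0 x) => // x0 _ y0 /esym xy.
  by rewrite addr_gt0 ?mulr_gt0.
have {}y0 : y < 0 by move: y0 xy; case: ltgtP.
apply: lt_gtF; rewrite -oppr_gt0 opprD -!mulrN addr_gt0 // mulr_gt0 //;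
  by rewrite oppr_gt0.
Qed.

(* The weights [la] and [mu] solve the linear system that expresses the chord
   between edges k and k + 3 through those of the two given crossings, in
   [third_crossing]. *)
Lemma crossing_weights (R : realType) (be ga : R) :
  0 < be -> be < 1 -> 0 < ga -> ga < 1 ->
  exists la mu, [/\ 0 < la < 1, 0 < mu < 1, la + mu * (1 - ga) = 1 & la * be + mu = 1].
Proof.
move=> be0 be1 ga0 ga1; have bega0 : 0 < be * ga by rewrite mulr_gt0.
have bega1 : 0 < (1 - be) * (1 - ga) by rewrite mulr_gt0 // subr_gt0.
have D0 : 0 < 1 - be + be * ga by lra.
have nD := lt0r_neq0 D0.
exists (ga / (1 - be + be * ga)), ((1 - be) / (1 - be + be * ga)); split.
- by rewrite divr_gt0 // ltr_pdivrMr // mul1r; lra.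
- by rewrite divr_gt0 ?subr_gt0 // ltr_pdivrMr // mul1r; lra.
- by field.
- by field.
Qed.

(** * Crossings between two edges in a generic projection *)

Section Polygon.
Context (R : realType) (n : nat) (p : 'I_n.+1 -> 'rV[R]_3) (xi : 'rV[R]_3).
Context (n_gt0 : (0 < n)%N) (G : generic (polygonal_curve p) xi).
Local Notation g := (polygonal_curve p).
Local Notation double := (double_point g xi).
Local Notation cross k l := (det3 (edge p k) (edge p l) xi).

Definition edge_crossing k l s t := [/\ double s t, on_edge p k s & on_edge p l t].

Lemma cross_neq0 k l s t : edge_crossing k l s t -> cross k l != 0.
Proof.
move=> [d [_ dk _] [_ dl _]]; case: G => _ _ /(_ _ _ d)[_ _ _].
by rewrite dk dl det3Zl det3Zr !mulf_eq0 !negb_or => /and3P[].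
Qed.

Lemma edge_crossing_vec k l s t : (k < n)%N -> (l < n)%N -> edge_crossing k l s t ->
  exists h, p (inord k) + (n%:R * s - k%:R) *: edge p k -
    (p (inord l) + (n%:R * t - l%:R) *: edge p l) = h *: xi.
Proof.
move=> kn ln [[_ _ _ /projP e] ks lt]; exists (dot (g s) xi - dot (g t) xi).
by rewrite -(on_edgeE kn ks) -(on_edgeE ln lt).
Qed.

(** Genericity makes the determinant of the two edges nonzero. This excludes a single edge, and also
    consecutive edges, which already meet at their common vertex. *)
Lemma double_point_edges s t : double s t -> s < t ->
  exists k l, [/\ (k.+1 < l)%N, (l < n)%N & edge_crossing k l s t].
Proof.
move=> d st; case: (G) => _ _ GG.
have [s01 ds _ _] := GG _ _ d; have [t01 dt _ _] := GG _ _ (double_pointC d).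
have [k kn ks] := on_edge_exists n_gt0 s01 ds.
have [l ln lt] := on_edge_exists n_gt0 t01 dt.
have c : edge_crossing k l s t by split.
exists k, l; split => //; have c0 := cross_neq0 c.
have kl : (k <= l)%N.
  case: ks lt => /andP[ks _] _ _ [/andP[_ tl] _ _].
  rewrite -ltnS -(ltr_nat R) (le_lt_trans ks) // (le_lt_trans _ tl) //.
  by rewrite ler_wpM2l // ltW.
rewrite ltn_neqAle ltn_neqAle kl andbT; apply/andP; split; last first.
  by apply: contraNneq c0 => ->; rewrite det3_diag12.
apply: contraNneq c0 => e; have [h] := edge_crossing_vec kn ln c; rewrite -e vertexS => E.
(* The chord through the common vertex, paired with edge [k.+1], leaves [n s - (k + 1)] times the
   determinant; the first factor is negative. *)
have /det3_dependent/(_ (edge p k.+1)) : (n%:R * s - k%:R - 1) *: edge p k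
    + (k.+1%:R - n%:R * t) *: edge p k.+1 + 0 *: 0 = h *: xi.
  by rewrite -E; apply/rowP => i; rewrite !mxE; ring.
rewrite det3_diag12 mulr0 mul0r !addr0 => /eqP; rewrite mulf_eq0 => /orP[|//].
by case: ks => /andP[_]; rewrite -natr1 => sk _ _ /eqP sk'; lra.
Qed.

(** The difference of the two chords, paired with edge [l], leaves [n (s - s')] times a nonzero
    determinant; genericity then gives [t = t']. *)
Lemma edge_crossing_unique k l s t s' t' : (k < n)%N -> (l < n)%N ->
  edge_crossing k l s t -> edge_crossing k l s' t' -> (s, t) = (s', t').
Proof.
move=> kn ln c c'; have [h E] := edge_crossing_vec kn ln c.
have [h' E'] := edge_crossing_vec kn ln c'.
have /det3_dependent/(_ (edge p l)) : (n%:R * s - n%:R * s') *: edge p k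
    + (n%:R * t' - n%:R * t) *: edge p l + 0 *: 0 = (h - h') *: xi.
  by rewrite [RHS]scalerBl -E -E'; apply/rowP => i; rewrite !mxE; ring.
rewrite det3_diag12 mulr0 mul0r !addr0 -mulrBr => /eqP; rewrite !mulf_eq0 pnatr_eq0.
rewrite (negbTE (cross_neq0 c)) orbF eqn0Ngt n_gt0 subr_eq0 /= => /eqP ss'.
case: c c' => d _ _ [d' _ _]; rewrite -ss' in d' *.
by case: (G) => _ /(_ _ _ _ d d') ->.
Qed.

(** Between the two crossings the path along edges [l] and [l.+1] leaves the line of edge [k] and
    comes back to it, so the directions are opposite. Pairing with edge [k] expresses this. *)
Lemma consecutive_under_signs k l s t s' t' : (k < n)%N -> (l.+1 < n)%N ->
  edge_crossing k l s t -> edge_crossing k l.+1 s' t' ->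
  (0 < cross k l) = ~~ (0 < cross k l.+1).
Proof.
move=> kn ln c c'; have [h E] := edge_crossing_vec kn (ltnW ln) c.
have [h' E'] := edge_crossing_vec kn ln c'; move: E'; rewrite vertexS => E'.
have /det3_dependent/(_ (edge p k)) : (l.+1%:R - n%:R * t) *: edge p l
    + (n%:R * t' - l.+1%:R) *: edge p l.+1
    + (n%:R * s - n%:R * s') *: edge p k = (h - h') *: xi.
  by rewrite [RHS]scalerBl -E -E'; apply/rowP => i; rewrite !mxE; ring.
rewrite det3_diag12 mulr0 addr0 det3C [det3 (edge p l.+1) _ _]det3C => e.
apply: (@opposite_signs _ (l.+1%:R - n%:R * t) (n%:R * t' - l.+1%:R)).
- by case: c => _ _ [/andP[_ ?] _ _]; rewrite subr_gt0.
- by case: c' => _ _ [/andP[? _] _ _]; rewrite subr_ge0.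
- exact: cross_neq0 c.
- exact: cross_neq0 c'.
- by move: e; rewrite !mulrN -opprD => /eqP; rewrite oppr_eq0 => /eqP.
Qed.

(** Here the path runs along edges [k] and [k.+1], and the line is that of edge [l]. *)
Lemma consecutive_over_signs k l s t s' t' : (k.+1 < n)%N -> (l < n)%N ->
  edge_crossing k l s t -> edge_crossing k.+1 l s' t' ->
  (0 < cross k l) = ~~ (0 < cross k.+1 l).
Proof.
move=> kn ln c c'; have [h E] := edge_crossing_vec (ltnW kn) ln c.
have [h' E'] := edge_crossing_vec kn ln c'; move: E'; rewrite vertexS => E'.
have /det3_dependent/(_ (edge p l)) : (k.+1%:R - n%:R * s) *: edge p k
    + (n%:R * s' - k.+1%:R) *: edge p k.+1
    + (n%:R * t - n%:R * t') *: edge p l = (h' - h) *: xi.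
  by rewrite [RHS]scalerBl -E -E'; apply/rowP => i; rewrite !mxE; ring.
rewrite det3_diag12 mulr0 addr0 => e.
apply: (@opposite_signs _ (k.+1%:R - n%:R * s) (n%:R * s' - k.+1%:R)) => //.
- by case: c => _ [/andP[_ ?] _ _] _; rewrite subr_gt0.
- by case: c' => _ [/andP[? _] _ _] _; rewrite subr_ge0.
- exact: cross_neq0 c.
- exact: cross_neq0 c'.
Qed.

(** When the strand at [t] is on top, the first two arguments of the determinant are exchanged,
    which reverses its sign. *)
Lemma crossing_sign_gt0 k l s t : edge_crossing k l s t ->
  (0 < crossing_sign g xi s t) = (over g xi s t == (0 < cross k l)).
Proof.
move=> c; have := cross_neq0 c; case: c => d [_ dk _] [_ dl _].
have n2 : 0 < n%:R * n%:R :> R by rewrite mulr_gt0 ?ltr0n.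
rewrite /crossing_sign dk dl !(det3Zl, det3Zr) !mulrA sgr_gt0.
case: over => /=; first by rewrite pmulr_rgt0 // => _; case: (0 < _).
rewrite [det3 (edge p l) _ _]det3C mulrN oppr_gt0 pmulr_rlt0 // => c0.
rewrite ltNge le_eqVlt.
by rewrite [0 == _]eq_sym (negbTE c0); case: (0 < _).
Qed.

Lemma overE s t : over g xi s t = (0 < dot (g s) xi - dot (g t) xi).
Proof. by rewrite subr_gt0. Qed.

Lemma on_edge_inj k l s : k%:R <= n%:R * s < k.+1%:R -> on_edge p l s -> l = k.
Proof.
move=> /andP[ks sk] [/andP[ls sl] _ _]; apply/eqP; rewrite eqn_leq -ltnS -(ltnS k).
by rewrite -!(ltr_nat R) (le_lt_trans ls sk) (le_lt_trans ks sl).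
Qed.

End Polygon.

(** In the projection, crossing [a] closes a triangle with sides on edges [k], [k.+1] and [k.+2].
    Edge [k.+3] starts at the end of edge [k.+2], outside the triangle, and reaches the side [k.+1]
    at [c]; it must enter through edge [k], after [a] and before reaching [c]. The new chord is a
    positive combination of those of [a] and [c], and so is its height difference. *)
Lemma third_crossing (R : realType) (n : nat) (p : 'I_n.+1 -> 'rV[R]_3) xi
    k sa ta sc tc :
  generic (polygonal_curve p) xi -> (k.+3 < n)%N ->
  edge_crossing p xi k k.+2 sa ta -> edge_crossing p xi k.+1 k.+3 sc tc ->
  exists sb tb, [/\ edge_crossing p xi k k.+3 sb tb, sa < sb, tb < tc &
    over (polygonal_curve p) xi sa ta = over (polygonal_curve p) xi sc tc ->
    over (polygonal_curve p) xi sb tb = over (polygonal_curve p) xi sa ta].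
Proof.
move=> G k3n a c; have n_gt0 : (0 < n)%N by apply: leq_trans k3n.
have [k2n k1n] : (k.+2 < n)%N /\ (k.+1 < n)%N.
  by split; rewrite ?(ltnW k3n) // ltnW // ltnW.
have kn := ltnW k1n; have N0 : 0 < n%:R :> R by rewrite ltr0n.
have [ha Ea] := edge_crossing_vec kn k2n a.
have [hc Ec] := edge_crossing_vec k1n k3n c.
have a0 := cross_neq0 G a; have c0 := cross_neq0 G c.
have [da [/andP[a1 a2] _ _] [/andP[b1 b2] _ b3]] := a.
have [dc [/andP[c1 c2] _ c3] [/andP[d1 d2] _ d3]] := c.
have [N EN] : exists N : R, n%:R = N by exists n%:R.
have [K EK] : exists K : R, k%:R = K by exists k%:R.
have K1 : k.+1%:R = K + 1 :> R by rewrite -natr1 EK.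
have K2 : k.+2%:R = K + 2 :> R by rewrite -natr1 K1 -addrA.
have K3 : k.+3%:R = K + 3 :> R by rewrite -natr1 K2 -addrA; congr (_ + _); ring.
have K4 : k.+4%:R = K + 4 :> R by rewrite -natr1 K3 -addrA; congr (_ + _); ring.
have K0 : 0 <= K by rewrite -EK ler0n.
have KN : K + 4 <= N by rewrite -K4 -EN ler_nat.
rewrite ?EN ?EK ?K1 ?K2 ?K3 ?K4 in N0 Ea Ec a1 a2 b1 b2 b3 c1 c2 c3 d1 d2 d3.
(* [al], [be], [ga], [de] are the relative positions of the four passages on their edges. *)
have [al alE] : exists al, N * sa - K = al by exists (N * sa - K).
have [be beE] : exists be, N * ta - (K + 2) = be by exists (N * ta - (K + 2)).
have [ga gaE] : exists ga, N * sc - (K + 1) = ga by exists (N * sc - (K + 1)).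
have [de deE] : exists de, N * tc - (K + 3) = de by exists (N * tc - (K + 3)).
rewrite alE beE in Ea; rewrite gaE deE in Ec.
have {}Ea : (al - 1) *: edge p k + (-1) *: edge p k.+1 + (- be) *: edge p k.+2
    = ha *: xi.
  by rewrite -Ea !vertexS; apply/rowP => i; rewrite !mxE; ring.
have {}Ec : (ga - 1) *: edge p k.+1 + (-1) *: edge p k.+2 + (- de) *: edge p k.+3
    = hc *: xi.
  by rewrite -Ec !vertexS; apply/rowP => i; rewrite !mxE; ring.
have al0 : 0 <= al by rewrite -alE subr_ge0.
have al1 : al < 1 by rewrite -alE; clear - a2; lra.
have be1 : be < 1 by rewrite -beE; clear - b2; lra.
have ga1 : ga < 1 by rewrite -gaE; clear - c2; lra.
have de1 : de < 1 by rewrite -deE; clear - d2; lra.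
(* A passage at the start of its edge lies at a vertex between two equal edges; the chord relation
   then makes the determinant of a crossing vanish. The same argument gives [ga0] and [de0]. *)
have be0 : 0 < be.
  rewrite lt_neqAle -{2}beE subr_ge0 b1 andbT eq_sym; apply: contraNneq a0 => be0.
  have [|_ /= e] := b3; first by apply/eqP; rewrite -subr_eq0 beE be0.
  have := det3_dependent Ea (edge p k); rewrite be0 e det3_diag12.
  rewrite det3C mulr0 add0r oppr0 mul0r addr0 mulN1r opprK => ->.
  by rewrite eqxx.
have ga0 : 0 < ga.
  rewrite lt_neqAle -{2}gaE subr_ge0 c1 andbT eq_sym; apply: contraNneq a0 => ga0.
  have [|_ /= e] := c3; first by apply/eqP; rewrite -subr_eq0 gaE ga0.
  have := det3_dependent Ea (edge p k.+2); rewrite -e det3_diag12 mulr0 addr0.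
  move/eqP; rewrite -mulrDl mulf_eq0 => /orP[/eqP al2|//]; exfalso.
  by clear - al1 al2; lra.
have de0 : 0 < de.
  rewrite lt_neqAle -{2}deE subr_ge0 d1 andbT eq_sym; apply: contraNneq c0 => de0.
  have [|_ /= e] := d3; first by apply/eqP; rewrite -subr_eq0 deE de0.
  have := det3_dependent Ec (edge p k.+1); rewrite de0 e det3_diag12.
  rewrite det3C mulr0 add0r oppr0 mul0r addr0 mulN1r opprK => ->.
  by rewrite eqxx.
have [la [mu [/andP[la0 la1] /andP[mu0 mu1] E1 E2]]] := crossing_weights be0 be1 ga0 ga1.
have x0 : 0 < la * (1 - al) by rewrite mulr_gt0 // subr_gt0.
have x1 : la * (1 - al) < 1 - al by rewrite gtr_pMl // subr_gt0.
have y0 : 0 < mu * de by rewrite mulr_gt0.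
have y1 : mu * de < de by rewrite gtr_pMl.
(* The parameters are read off from the coefficients of edges [k] and [k.+3] in [la] times the chord
   of [a] plus [mu] times that of [c]. *)
have [sb sbE] : exists sb, N * sb = K + 1 - la * (1 - al).
  by exists ((K + 1 - la * (1 - al)) / N); rewrite mulrC divfK ?gt_eqF.
have [tb tbE] : exists tb, N * tb = K + 3 + mu * de.
  by exists ((K + 3 + mu * de) / N); rewrite mulrC divfK ?gt_eqF.
have sbI : K <= N * sb < K + 1.
  by rewrite sbE; clear - x0 x1 al0; apply/andP; split; lra.
have tbI : K + 3 <= N * tb < K + 4.
  by rewrite tbE; clear - y0 y1 de1; apply/andP; split; lra.
have vec : polygonal_curve p sb - polygonal_curve p tb =
    la *: (polygonal_curve p sa - polygonal_curve p ta) +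
    mu *: (polygonal_curve p sc - polygonal_curve p tc).
  case: a c => [_ oa1 oa2] [_ oc1 oc2].
  rewrite (on_edgeE kn oa1) (on_edgeE k2n oa2) (on_edgeE k1n oc1) (on_edgeE k3n oc2).
  rewrite (polygonal_curve_edge _ kn) ?EN ?EK ?K1; last first.
    by case/andP: sbI => -> /ltW.
  rewrite (polygonal_curve_edge _ k3n) ?EN ?K2 ?K3 ?K4; last first.
    by case/andP: tbI => -> /ltW.
  rewrite sbE tbE alE beE gaE deE !vertexS; apply/rowP => i; rewrite !mxE.
  (* [E1] and [E2] make the coefficients of edges [k.+1] and [k.+2] equal to -1. *)
  have := congr1 (fun x => x * (p (inord k.+2) 0 i - p (inord k.+1) 0 i)) E1.
  have := congr1 (fun x => x * (p (inord k.+3) 0 i - p (inord k.+2) 0 i)) E2.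
  move: (p (inord k) 0 i) (p (inord k.+1) 0 i) (p (inord k.+2) 0 i)
    (p (inord k.+3) 0 i) (p (inord k.+4) 0 i) => q0 q1 q2 q3 q4.
  by clear; lra.
have height : dot (polygonal_curve p sb) xi - dot (polygonal_curve p tb) xi =
    la * (dot (polygonal_curve p sa) xi - dot (polygonal_curve p ta) xi) +
    mu * (dot (polygonal_curve p sc) xi - dot (polygonal_curve p tc) xi).
  by rewrite -!dotB vec dot_linear dotZ.
have stb : sb < tb.
  case/andP: sbI tbI => _ sb1 /andP[tb1 _].
  rewrite -(ltr_pM2l N0) (lt_trans sb1) // (lt_le_trans _ tb1) //.
  by rewrite ltrD2l (ltr_nat R 1 3).
have in01 x : K <= N * x < K + 4 -> 0 <= x <= 1.
  move=> /andP[Kx xK]; rewrite -(ler_pM2l N0) mulr0 -[_ <= 1](ler_pM2l N0) mulr1.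
  by rewrite (le_trans K0 Kx) (le_trans (ltW xK) KN).
have db : double_point (polygonal_curve p) xi sb tb.
  split.
  - by apply: in01; case/andP: sbI => -> /=; clear; lra.
  - by apply: in01; case/andP: tbI => + ->; clear; lra.
  - by rewrite lt_eqF.
  - apply/projP; case: da dc => _ _ _ /projP ea [_ _ _ /projP ec].
    by rewrite vec height ea ec !scalerA -scalerDl.
(* This supplies the derivative conditions of [on_edge]; the intervals [sbI] and [tbI] identify the
   edges. *)
have [k' [l' [_ _ b]]] := double_point_edges n_gt0 G db stb.
have kk : k' = k by case: b => _ ob _; apply: on_edge_inj ob; rewrite EN EK K1.
have ll : l' = k.+3 by case: b => _ _ ob; apply: on_edge_inj ob; rewrite EN K3 K4.
rewrite {}kk {}ll in b; exists sb, tb; split; first exact: b.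
- rewrite -(ltr_pM2l N0) sbE -(addrNK K (N * sa)) alE.
  by clear - x1; lra.
- rewrite -(ltr_pM2l N0) tbE -(addrNK (K + 3) (N * tc)) deE.
  by clear - y1; lra.
- rewrite !overE height; apply: positive_combination_gt0 => //.
    by rewrite subr_eq0; case: (G) => _ _ /(_ _ _ da)[].
  by rewrite subr_eq0; case: (G) => _ _ /(_ _ _ dc)[].
Qed.

(** * Curves with four edges *)

Lemma alt_number_00 o1 o2 e1 e2 : alt_number [:: (0, o1, e1); (0, o2, e2)]%N = 0.
Proof.
by rewrite /alt_number unlock; case: o1; case: o2; case: e1; case: e2; vm_compute.
Qed.

Lemma alt_number_nested a b oa ob ea eb : (a, b) \in [:: (0, 1); (1, 0)]%N ->
  alt_number [:: (a, oa, ea); (b, ob, eb); (b, ~~ ob, eb); (a, ~~ oa, ea)] = 0.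
Proof.
rewrite /alt_number unlock !inE !xpair_eqE => /orP[]/andP[/eqP-> /eqP->];
  by case: oa; case: ob; case: ea; case: eb; vm_compute.
Qed.

(** With opposite orientation bits [~~ b] and [b], the signs are equal exactly when the levels [o1]
    and [o2] differ, which is also the condition for an alternating pair. *)
Lemma alt_number_0101 o1 o2 b :
  let w := [:: (0, o1, o1 == ~~ b); (1, o2, o2 == b);
               (0, ~~ o1, o1 == ~~ b); (1, ~~ o2, o2 == b)]%N in
  alt_number w = 0 \/
  exists o e, w = [:: (0, o, e); (1, ~~ o, e); (0, ~~ o, e); (1, o, e)]%N.
Proof.
have [->|] := eqVneq o2 o1.
  by left; rewrite /alt_number unlock; case: o1; case: b; vm_compute.
by case: o1; case: o2 => // _; right; [exists true, (~~ b)|exists false, b]; case: b.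
Qed.

(** When their levels differ, the pairs [(0, 1)] and [(1, 2)] count 1 and [(0, 2)] counts -1. If
    [o1] and [o3] differ, [o2] differs from exactly one of them and the terms cancel; otherwise the
    hypothesis makes all levels equal. *)
Lemma alt_number_012012 o1 o2 o3 b : (o1 = o3 -> o2 = o1) ->
  alt_number [:: (0, o1, o1 == ~~ ~~ b); (1, o2, o2 == ~~ b); (2, o3, o3 == b);
    (0, ~~ o1, o1 == ~~ ~~ b); (1, ~~ o2, o2 == ~~ b); (2, ~~ o3, o3 == b)]%N = 0.
Proof.
move=> h; rewrite /alt_number unlock; move: h.
by case: o1; case: o3; case: o2; case: b; vm_compute => // /(_ erefl).
Qed.

(** * Enumeration of the crossings of a curve with four edges *)

Lemma crossings_of_edges (R : realType) (n : nat) (p : 'I_n.+1 -> 'rV[R]_3) xi k l :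
  (0 < n)%N -> generic (polygonal_curve p) xi -> (k < n)%N -> (l < n)%N ->
  exists2 cs : seq (R * R), (forall c, c \in cs <-> edge_crossing p xi k l c.1 c.2) &
    cs = [::] \/ exists s t, edge_crossing p xi k l s t /\ cs = [:: (s, t)].
Proof.
move=> n0 G kn ln.
have [[s [t c]]|no] := pselect (exists s t, edge_crossing p xi k l s t).
  exists [:: (s, t)]; last by right; exists s, t.
  move=> [s' t'] /=; rewrite inE; split=> [/eqP[-> ->] //|c'].
  by rewrite (edge_crossing_unique n0 G kn ln c' c).
exists [::]; last by left.
by move=> [s t]; split => // c; case: no; exists s, t.
Qed.

(** Variables stand for level and orientation, so that relations between crossings become
    substitutions of booleans. *)
Lemma edge_crossing_bits (R : realType) (n : nat) (p : 'I_n.+1 -> 'rV[R]_3) xi k l s t :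
  (0 < n)%N -> generic (polygonal_curve p) xi -> edge_crossing p xi k l s t ->
  exists o b, [/\ over (polygonal_curve p) xi s t = o,
    (0 < det3 (edge p k) (edge p l) xi) = b &
    (0 < crossing_sign (polygonal_curve p) xi s t) = (o == b)].
Proof.
move=> n0 G c; exists (over (polygonal_curve p) xi s t).
by exists (0 < det3 (edge p k) (edge p l) xi); split=> //; exact: crossing_sign_gt0 c.
Qed.

Lemma polygon4_gauss_code (R : realType) (p : 'I_5 -> 'rV[R]_3) xi :
  generic (polygonal_curve p) xi ->
  exists2 w, is_gauss_code (polygonal_curve p) xi w & alt_number w = 0 \/
    exists o e, w = [:: (0, o, e); (1, ~~ o, e); (0, ~~ o, e); (1, o, e)]%N.
Proof.
move=> G; have n0 : (0 < 4)%N by [].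
have [A EA cA] := crossings_of_edges (k := 0) (l := 2) n0 G isT isT.
have [B EB cB] := crossings_of_edges (k := 0) (l := 3) n0 G isT isT.
have [C EC cC] := crossings_of_edges (k := 1) (l := 3) n0 G isT isT.
have D s t : double_point (polygonal_curve p) xi s t <->
    (s, t) \in A ++ B ++ C \/ (t, s) \in A ++ B ++ C.
  have mem x y : (x, y) \in A ++ B ++ C -> double_point (polygonal_curve p) xi x y.
    by rewrite !mem_cat => /or3P[/EA|/EB|/EC][].
  split; last by case=> [/mem//|/mem]; apply: double_pointC.
  have lt x y : double_point (polygonal_curve p) xi x y -> x < y ->
      (x, y) \in A ++ B ++ C.
    move=> d xy; have [k [l [kl l4 c]]] := double_point_edges n0 G d xy.
    rewrite !mem_cat; apply/or3P.
    have [[ek el]|[ek el]|[ek el]] :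
        [\/ k = 0%N /\ l = 2, k = 0%N /\ l = 3 | k = 1%N /\ l = 3]%N.
      by move: k l kl l4 {c} => [|[|[|k]]] [|[|[|[|l]]]] // _ _;
        [constructor 1|constructor 2|constructor 3].
    - by rewrite ek el in c; constructor 1; apply/EA.
    - by rewrite ek el in c; constructor 2; apply/EB.
    - by rewrite ek el in c; constructor 3; apply/EC.
  move=> d; case: (d) => _ _ + _; case: ltgtP => // st _; first by left; apply: lt.
  by right; apply: lt => //; apply: double_pointC.
have code ts := gauss_code_of_crossings (ts := ts) G D.
have ord2 k l s t : edge_crossing p xi k l s t ->
    k%:R <= 4 * s < k.+1%:R /\ l%:R <= 4 * t < l.+1%:R.
  by case=> _ [? _ _] [? _ _].
have two_entries s t : sorted <%R [:: s; t] -> A ++ B ++ C = [:: (s, t)] ->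
    exists2 w, is_gauss_code (polygonal_curve p) xi w & alt_number w = 0 \/
    exists o e, w = [:: (0, o, e); (1, ~~ o, e); (0, ~~ o, e); (1, o, e)]%N.
  move=> st e; have := code [:: s; t] st; rewrite e => /(_ (perm_refl _))[f H F].
  exists (map f [:: s; t]); first exact: H.
  by have [/= -> ->] := F 0%N isT; left; apply: alt_number_00.
(* Eight cases, according to which of the three possible crossings exist. *)
case: cA => [a0|[sa [ta [a aE]]]]; case: cB => [b0|[sb [tb [b bE]]]];
  case: cC => [c0|[sc [tc [c cE]]]].
- have := code [::] isT; rewrite a0 b0 c0 => /(_ isT)[f H _].
  by exists [::]; [exact: H|left; rewrite /alt_number big_nil].
- apply: (two_entries sc tc); last by rewrite a0 b0 cE.
  by have [/andP[_ ?] /andP[? _]] := ord2 _ _ _ _ c; rewrite /= andbT; lra.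
- apply: (two_entries sb tb); last by rewrite a0 bE c0.
  by have [/andP[_ ?] /andP[? _]] := ord2 _ _ _ _ b; rewrite /= andbT; lra.
- have [/andP[b1 b2] /andP[b3 b4]] := ord2 _ _ _ _ b.
  have [/andP[c1 c2] /andP[c3 c4]] := ord2 _ _ _ _ c.
  have e : A ++ B ++ C = [:: (sb, tb); (sc, tc)] by rewrite a0 bE cE.
  have [ob [vb [Ob Bb Sb]]] := edge_crossing_bits n0 G b.
  have [oc [vc [Oc Bc Sc]]] := edge_crossing_bits n0 G c.
  have pbc : vb = ~~ vc.
    by rewrite -Bb -Bc; exact:
      (consecutive_over_signs G (k := 0%N) (l := 3%N) isT isT b c).
  (* The order on edge 3 decides between an interlaced and a nested word. Equality would make [sb]
     and [sc] coincide, although they lie on edges 0 and 1. *)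
  case: (ltgtP tb tc) => bc.
  + have := code [:: sb; sc; tb; tc]; rewrite e => -[||f H F].
    * by rewrite /= andbT; clear - bc b1 b2 b3 b4 c1 c2 c3 c4; apply/and3P; split; lra.
    * by apply/permP => P /=; ring.
    exists (map f [:: sb; sc; tb; tc]); first exact: H.
    have [/= f1 f2] := F 0%N isT; have [/= f3 f4] := F 1%N isT.
    rewrite Ob Sb pbc in f1 f2; rewrite Oc Sc in f3 f4.
    rewrite /= f1 f2 f3 f4; exact: alt_number_0101.
  + have := code [:: sb; sc; tc; tb]; rewrite e => -[||f H F].
    * by rewrite /= andbT; clear - bc b1 b2 b3 b4 c1 c2 c3 c4; apply/and3P; split; lra.
    * by apply/permP => P /=; ring.
    exists (map f [:: sb; sc; tc; tb]); first exact: H.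
    have [/= f1 f2] := F 0%N isT; have [/= f3 f4] := F 1%N isT.
    by left; rewrite /= f1 f2 f3 f4; apply: alt_number_nested.
  + case: b c => b _ _ [c _ _]; case: (G) => _ U _.
    have sbc : sb = sc.
      by apply: (U tb); [|rewrite bc]; apply: double_pointC.
    by clear - sbc b1 b2 c1 c2; lra.
- apply: (two_entries sa ta); last by rewrite aE b0 c0.
  by have [/andP[_ ?] /andP[? _]] := ord2 _ _ _ _ a; rewrite /= andbT; lra.
(* Crossings [a] and [c] without [b] are impossible. *)
- have [s [t [b _ _ _]]] := third_crossing G (k := 0%N) isT a c.
  by have /EB := b : edge_crossing p xi 0 3 (s, t).1 (s, t).2; rewrite b0.
- have [/andP[a1 a2] /andP[a3 a4]] := ord2 _ _ _ _ a.
  have [/andP[b1 b2] /andP[b3 b4]] := ord2 _ _ _ _ b.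
  have e : A ++ B ++ C = [:: (sa, ta); (sb, tb)] by rewrite aE bE c0.
  have [oa [va [Oa Ba Sa]]] := edge_crossing_bits n0 G a.
  have [ob [vb [Ob Bb Sb]]] := edge_crossing_bits n0 G b.
  have pab : va = ~~ vb.
    by rewrite -Ba -Bb; exact:
      (consecutive_under_signs G (k := 0%N) (l := 2%N) isT isT a b).
  (* Here the order on edge 0 decides. *)
  case: (ltgtP sa sb) => ab.
  + have := code [:: sa; sb; ta; tb]; rewrite e => -[||f H F].
    * by rewrite /= andbT; clear - ab a1 a2 a3 a4 b1 b2 b3 b4; apply/and3P; split; lra.
    * by apply/permP => P /=; ring.
    exists (map f [:: sa; sb; ta; tb]); first exact: H.
    have [/= f1 f2] := F 0%N isT; have [/= f3 f4] := F 1%N isT.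
    rewrite Oa Sa pab in f1 f2; rewrite Ob Sb in f3 f4.
    rewrite /= f1 f2 f3 f4; exact: alt_number_0101.
  + have := code [:: sb; sa; ta; tb]; rewrite e => -[||f H F].
    * by rewrite /= andbT; clear - ab a1 a2 a3 a4 b1 b2 b3 b4; apply/and3P; split; lra.
    * by apply/permP => P /=; ring.
    exists (map f [:: sb; sa; ta; tb]); first exact: H.
    have [/= f1 f2] := F 0%N isT; have [/= f3 f4] := F 1%N isT.
    by left; rewrite /= f1 f2 f3 f4; apply: alt_number_nested.
  + case: a b => a _ _ [b _ _]; case: (G) => _ U _.
    have tab : ta = tb by apply: (U sa) => //; rewrite ab.
    by clear - tab a3 a4 b3 b4; lra.
(* By uniqueness the crossing produced is [b]. Its position fixes the word [012012], and its height
   yields the constraint on the levels. *)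
- have [s [t [b' ab bc hb]]] := third_crossing G (k := 0%N) isT a c.
  have [es et] := edge_crossing_unique n0 G (k := 0%N) (l := 3%N) isT isT b' b.
  rewrite {}es {}et in ab bc hb.
  have [/andP[a1 a2] /andP[a3 a4]] := ord2 _ _ _ _ a.
  have [/andP[b1 b2] /andP[b3 b4]] := ord2 _ _ _ _ b.
  have [/andP[c1 c2] /andP[c3 c4]] := ord2 _ _ _ _ c.
  have [oa [va [Oa Ba Sa]]] := edge_crossing_bits n0 G a.
  have [ob [vb [Ob Bb Sb]]] := edge_crossing_bits n0 G b.
  have [oc [vc [Oc Bc Sc]]] := edge_crossing_bits n0 G c.
  have pab : va = ~~ vb.
    by rewrite -Ba -Bb; exact:
      (consecutive_under_signs G (k := 0%N) (l := 2%N) isT isT a b).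
  have pbc : vb = ~~ vc.
    by rewrite -Bb -Bc; exact:
      (consecutive_over_signs G (k := 0%N) (l := 3%N) isT isT b c).
  have e : A ++ B ++ C = [:: (sa, ta); (sb, tb); (sc, tc)] by rewrite aE bE cE.
  have := code [:: sa; sb; sc; ta; tb; tc]; rewrite e => -[||f H F].
  + by rewrite /= andbT; clear - ab bc a1 a2 a3 a4 b1 b2 b3 b4 c1 c2 c3 c4;
      apply/and5P; split; lra.
  + by apply/permP => P /=; ring.
  exists (map f [:: sa; sb; sc; ta; tb; tc]); first exact: H.
  have [/= f1 f2] := F 0%N isT; have [/= f3 f4] := F 1%N isT.
  have [/= f5 f6] := F 2%N isT.
  rewrite Oa Sa pab pbc in f1 f2; rewrite Ob Sb pbc in f3 f4; rewrite Oc Sc in f5 f6.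
  left; rewrite /= f1 f2 f3 f4 f5 f6; apply: alt_number_012012.
  by rewrite -Oa -Ob -Oc; exact: hb.
Qed.

(** * From generic directions to the integrals *)

Lemma spherical_standard o e :
  let w : gauss_code := [:: (0, o, e); (1, ~~ o, e); (0, ~~ o, e); (1, o, e)]%N in
  gauss_word w && spherical w.
Proof. by case: o; case: e; vm_compute. Qed.

Lemma alternating_sum_k2_1 (R : realType) (p : 'I_5 -> 'rV[R]_3) xi :
  generic (polygonal_curve p) xi ->
  alternating_sum (polygonal_curve p) xi =
  if `[< projects_to_k2_1 (polygonal_curve p) xi >] then 1 else 0.
Proof.
move=> G; have [w Hw w01] := polygon4_gauss_code G.
rewrite (alternating_sum_alt_number G Hw).
case: asboolP => [[D HD /is_k2_1_alt_number D1]|not_k2_1].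
  (* [w] and the code of [D] may differ, but both compute the same alternating sum. *)
  by rewrite -(alternating_sum_alt_number G Hw) (alternating_sum_alt_number G HD) D1.
case: w01 => [->//|[ov [e ew]]]; case: not_k2_1; rewrite ew in Hw.
pose D : knotoid_diagram :=
  exist (fun w => gauss_word w && spherical w) _ (spherical_standard ov e).
exists D; first exact: Hw.
(* The projection already gives a standard diagram, so reflexivity suffices. *)
exists D; last exact: Relation_Operators.rst_refl.
by exists 0%N, 1%N, ov, e.
Qed.

Theorem proposition7p2 (R : realType) (p : 'I_5 -> 'rV[R]_3) :
  SLL (polygonal_curve p) =
  ((2^-1)%:E * geometric_probability
    [set xi | generic (polygonal_curve p) xi /\
              projects_to_k2_1 (polygonal_curve p) xi])%E.
Proof.
(* The factor [8 pi] splits as [2 * (4 pi)]; the integrands are then compared direction by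
   direction. *)
rewrite /SLL /geometric_probability muleA -EFinM -invfM mulrA -natrM.
congr (_ * sphere_integral _)%E; apply/funext => xi; rewrite indicE.
(* At a non-generic direction both integrands vanish, the right one because its set contains generic
   directions only. *)
case: asboolP => [G|nG]; last by rewrite memNset // => -[].
rewrite alternating_sum_k2_1 //; case: asboolP => [k|nk].
  by rewrite mem_set.
by rewrite memNset // => -[].
Qed.
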